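(* Let $R$ be a left Zacharias domain which is a (commutative) principal ideal domain, let $\mathsf R$ be a multivariate Ore extension of $R$ in which each $\alpha_i$ is an automorphism of $R$, and let $F=\{g_1,\dots,g_u\}\subset\mathsf R^m\setminus\{0\}$, $\mathbf M(g_i)=c_i\tau_i\mathbf e_{l_i}$, $\mathsf M=\mathbb I_L(F)$. For $1\le i<j\le u$ with $\mathbf e_{l_i}=\mathbf e_{l_j}$ put $\tau(i,j)=\mathrm{lcm}(\tau_i,\tau_j)$, $a_{ij}=\alpha_{\tau(i,j)/\tau_i}(c_i)$, $a_{ji}=\alpha_{\tau(i,j)/\tau_j}(c_j)$, $c(i,j)=\mathrm{lcm}(a_{ij},a_{ji})\in R$ and $$b(i,j)=\frac{c(i,j)}{a_{ji}}\frac{\tau(i,j)}{\tau_j}e_j-\frac{c(i,j)}{a_{ij}}\frac{\tau(i,j)}{\tau_i}e_i,\qquad B(i,j)=\frac{c(i,j)}{a_{ji}}\frac{\tau(i,j)}{\tau_j}\star g_j-\frac{c(i,j)}{a_{ij}}\frac{\tau(i,j)}{\tau_i}\star g_i.$$ Then $\{b(i,j):1\le i<j\le u,\ \mathbf e_{l_i}=\mathbf e_{l_j}\}$ is a left Gebauer–Möller set for $F$; consequently $F$ is a left Gröbner basis of $\mathsf M$ if and only if each $B(i,j)$, $1\le i<j\le u$, $\mathbf e_{l_i}=\mathbf e_{l_j}$, has a left weak Gröbner representation in terms of $F$.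
   Context: **Ore extensions.** A multivariate Ore extension $\mathsf R=R[Y_1;\alpha_1,\delta_1]\cdots[Y_n;\alpha_n,\delta_n]$ of a domain $R$ is an iterated Ore extension ($Y_i\star r=\alpha_i(r)Y_i+\delta_i(r)$, $\alpha_i$ an injective ring endomorphism mapping $R$ to $R$, $\delta_i$ an $\alpha_i$-derivation mapping $R$ to $R$) such that $\alpha_j\delta_i=\delta_i\alpha_j$ for $i\ne j$, $\alpha_i\alpha_j=\alpha_j\alpha_i$, $\delta_i\delta_j=\delta_j\delta_i$, and $\alpha_j(Y_i)=Y_i$, $\delta_j(Y_i)=0$ for $i<j$. Its multiplication is $\star$. It is a free left $R$-module on the set of terms $\mathcal T=\{Y_1^{a_1}\cdots Y_n^{a_n}\}$, a commutative monoid. For $\tau=Y_1^{a_1}\cdots Y_n^{a_n}$ put $\alpha_\tau=\alpha_1^{a_1}\cdots\alpha_n^{a_n}:R\to R$. The associated graded Ore extension $\mathsf S=R[Y_1;\alpha_1]\cdots[Y_n;\alpha_n]$ is the same left $R$-module with multiplication $\ast$ determined by $(a\tau)\ast(b\omega)=a\,\alpha_\tau(b)\,\tau\omega$. **Orderings.** $\mathsf R^m$ has canonical basis $\mathbf e_1,\dots,\mathbf e_m$ and terms $\mathcal T^{(m)}=\{t\mathbf e_i\}$. Fix a term ordering $\prec$ on $\mathcal T$ and a compatible term ordering $<$ on $\mathcal T^{(m)}$: a well-ordering with $\omega_1\prec\omega_2\Rightarrow\omega_1t<\omega_2t$ and $t_1<t_2\Rightarrow\omega t_1<\omega t_2$.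 $\mathbf T(f)$, $\mathrm{lc}(f)$, $\mathbf M(f)=\mathrm{lc}(f)\mathbf T(f)$ are maximal term, leading coefficient and maximal monomial. **Gröbner notions.** $\mathbb I_L(F)$ is the left $\mathsf R$-module generated by $F$. $F$ is a left (weak) Gröbner basis of $\mathsf M=\mathbb I_L(F)$ if for every $f\in\mathsf M\setminus\{0\}$, $\mathbf M(f)=\sum_ia_i\lambda_i\ast\mathbf M(g_{j_i})$ with $a_i\in R\setminus\{0\}$, $\lambda_i\in\mathcal T$, $\lambda_i\mathbf T(g_{j_i})=\mathbf T(f)$. A left weak Gröbner representation of $f$ is $f=\sum_ia_i\lambda_i\star g_{j_i}$ with $a_i\in R\setminus\{0\}$, $\lambda_i\in\mathcal T$, $\lambda_i\mathbf T(g_{j_i})\le\mathbf T(f)$ for all $i$ (zero has the empty representation). **Gebauer–Möller sets.** Let $e_1,\dots,e_u$ be the canonical basis of $\mathsf S^u$ and $\mathfrak s_L:\mathsf S^u\to\mathsf S^m$, $\mathfrak s_L(\sum h_ie_i)=\sum h_i\ast\mathbf M(g_i)$. An element $\sum a_i\lambda_ie_i$ ($a_i\in R,\lambda_i\in\mathcal T$) is $\mathcal T^{(m)}$-homogeneous if $\lambda_i\mathbf T(g_i)$ is the same term for all $i$ with $a_i\ne0$. A left Gebauer–Möller set for $F$ is a set of $\mathcal T^{(m)}$-homogeneous generators of the left $\mathsf S$-module $\ker(\mathfrak s_L)$. **Zacharias ring.** A ring $R$ with identity is a left Zacharias ring if (a) it is noetherian; (b) there is an algorithm which, given $c\in R^m$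 and a finite $C=\{c_1,\dots,c_t\}\subset R^m\setminus\{0\}$, decides whether $c$ lies in the left module generated by $C$ and, if so, produces $d_i\in R$ with $c=\sum d_ic_i$; (c) there is an algorithm which, given $\{c_1,\dots,c_t\}\subset R^m\setminus\{0\}$, computes a finite set of generators of the left syzygy module $\{(d_1,\dots,d_t)\in R^t:\sum d_ic_i=0\}$. *)

(* Defs.v *)
From HB Require Import structures.
From mathcomp Require Import all_boot all_order all_algebra.
From mathcomp Require Export mpoly.
From Stdlib Require Import ClassicalEpsilon.

Set Implicit Arguments.
Unset Strict Implicit.
Unset Printing Implicit Defensive.

Import GRing.Theory.
Local Open Scope ring_scope.

(** * Multivariate Ore extensions *)

Record ore_data (n : nat) (R : nzRingType) := OreData {
  alpha : 'I_n -> {rmorphism R -> R};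
  delta : 'I_n -> {additive R -> R};
  alpha_inj : forall i, injective (alpha i);
  deltaM : forall i a b, delta i (a * b) = alpha i a * delta i b + delta i a * b;
  alphaC : forall i j a, alpha i (alpha j a) = alpha j (alpha i a);
  deltaC : forall i j a, delta i (delta j a) = delta j (delta i a);
  alpha_deltaC :
    forall i j, i != j -> forall a, alpha j (delta i a) = delta i (alpha j a)
}.

(** [R[Y_1;alpha_1,delta_1]...[Y_n;alpha_n,delta_n]] is realised on the free
    left R-module on the terms, i.e. on the module underlying {mpoly R[n]};
    the commutative product of {mpoly R[n]} is not inherited. *)
Definition ore n R (D : ore_data n R) : Type := {mpoly R[n]}.

HB.instance Definition _ n R (D : ore_data n R) :=
  GRing.Lmodule.copy (ore D) {mpoly R[n]}.

Section OreRing.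
Context (n : nat) (R : nzRingType) (D : ore_data n R).
Implicit Types (f g h : {mpoly R[n]}) (t s : 'X_{1..n}) (i j : 'I_n) (a b : R).

(** [alpha_i] and [delta_i] extended by [alpha_i(Y_j) = Y_j], [delta_i(Y_j) = 0]. *)
Definition ahat i f : {mpoly R[n]} := map_mpoly (alpha D i) f.
Definition dhat i f : {mpoly R[n]} := map_mpoly (delta D i) f.

(** [f |-> Y_i * f]; the product below is that of {mpoly R[n]}: it shifts
    exponents and leaves coefficients unchanged. *)
Definition ore_varl i f : {mpoly R[n]} := ahat i f * 'X_i + dhat i f.

(** [f |-> Y_1^(t 1) ... Y_n^(t n) * f] *)
Definition ore_terml t f : {mpoly R[n]} :=
  foldr (fun i h => iter (t i) (ore_varl i) h) f (enum 'I_n).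

Definition ore_mul f g : {mpoly R[n]} :=
  \sum_(t <- msupp f) f@_t *: ore_terml t g.

(** [alpha_tau] *)
Definition alpha_term t a : R :=
  foldr (fun i b => iter (t i) (alpha D i) b) a (enum 'I_n).

HB.instance Definition _ i := GRing.Additive.copy (ahat i) (map_mpoly (alpha D i)).
HB.instance Definition _ i := GRing.Additive.copy (dhat i) (map_mpoly (delta D i)).

Lemma ahatZ i a f : ahat i (a *: f) = alpha D i a *: ahat i f.
Proof.
by apply/mpolyP=> t; rewrite !(mcoeff_map_mpoly, mcoeffZ) /= rmorphM.
Qed.

Lemma dhatZ i a f :
  dhat i (a *: f) = alpha D i a *: dhat i f + delta D i a *: f.
Proof.
apply/mpolyP=> t.
by rewrite !(mcoeffD, mcoeff_map_mpoly, mcoeffZ) /= deltaM.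
Qed.

Lemma delta1 i : delta D i 1 = 0.
Proof.
have := deltaM D i 1 1; rewrite mulr1 rmorph1 mul1r mulr1.
by move/eqP; rewrite -subr_eq0 opprD addrA subrr add0r oppr_eq0 => /eqP.
Qed.

Lemma ahatX i t : ahat i 'X_[t] = 'X_[t].
Proof. exact: map_mpolyX. Qed.

Lemma dhatX i t : dhat i 'X_[t] = 0.
Proof.
apply/mpolyP=> s; rewrite mcoeff_map_mpoly mcoeffX mcoeff0.
by case: (_ == _); rewrite ?raddf0 ?delta1.
Qed.

Lemma ore_varlD i : {morph ore_varl i : f g / f + g}.
Proof. by move=> f g; rewrite /ore_varl !raddfD /= mulrDl addrACA. Qed.

Lemma ore_varlZ i a f :
  ore_varl i (a *: f) = alpha D i a *: ore_varl i f + delta D i a *: f.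
Proof. by rewrite /ore_varl ahatZ dhatZ scalerDr -scalerAl addrA. Qed.

Lemma ore_varlX i t : ore_varl i 'X_[t] = 'X_[t + U_(i)].
Proof. by rewrite /ore_varl ahatX dhatX addr0 mpolyXD. Qed.

Lemma ore_varl0 i : ore_varl i 0 = 0.
Proof. by rewrite /ore_varl !raddf0 mul0r addr0. Qed.

Lemma mpoly_additive_ext (F G : {mpoly R[n]} -> {mpoly R[n]}) :
  F 0 = 0 -> G 0 = 0 -> {morph F : f g / f + g} -> {morph G : f g / f + g} ->
  (forall a t, F (a *: 'X_[t]) = G (a *: 'X_[t])) -> F =1 G.
Proof.
move=> F0 G0 FD GD FG; elim/mpolyind => [|a t p _ _ IH]; first by rewrite F0 G0.
by rewrite FD GD FG IH.
Qed.

Lemma ore_varlC i j f : ore_varl i (ore_varl j f) = ore_varl j (ore_varl i f).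
Proof.
have [-> //|neq_ij] := eqVneq i j.
move: f; apply: mpoly_additive_ext => [||f g|f g|a t]; rewrite ?ore_varl0 //.
- by rewrite !ore_varlD.
- by rewrite !ore_varlD.
rewrite !(ore_varlZ, ore_varlD, ore_varlX) (alphaC D i j) (deltaC D i j).
rewrite (alpha_deltaC D neq_ij) (@alpha_deltaC _ _ D j i) 1?eq_sym //.
rewrite -!addrA; congr (_ *: 'X_[_] + _); last by rewrite addrCA.
by rewrite -!addmA [(U_(_) + _)%MM]addmC.
Qed.

Lemma iter_ore_varlC i j k l f :
  iter k (ore_varl i) (iter l (ore_varl j) f) =
  iter l (ore_varl j) (iter k (ore_varl i) f).
Proof.
elim: k => //= k ->; elim: l => //= l <-.
exact: ore_varlC.
Qed.

Lemma ore_termlD t : {morph ore_terml t : f g / f + g}.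
Proof.
move=> f g; rewrite /ore_terml; elim: (enum _) => //= i r ->.
by elim: (t i) => //= k ->; rewrite ore_varlD.
Qed.

Lemma ore_terml0 t : ore_terml t 0 = 0.
Proof.
rewrite /ore_terml; elim: (enum _) => //= i r ->.
by elim: (t i) => //= k ->; rewrite ore_varl0.
Qed.

Lemma ore_terml_add t s f : ore_terml (t + s) f = ore_terml t (ore_terml s f).
Proof.
rewrite /ore_terml; elim: (enum _) => //= i r ->.
rewrite mnmDE iterD; congr (iter _ _ _).
move: (foldr (fun j h => iter (s j) (ore_varl j) h) f r) => h.
by elim: r => //= j r IH; rewrite iter_ore_varlC IH.
Qed.

Lemma ore_terml_id f : ore_terml 0%MM f = f.
Proof.
by rewrite /ore_terml; elim: (enum _) => //= i r ->; rewrite mnm0E.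
Qed.

Lemma ore_terml_var i f : ore_terml U_(i)%MM f = ore_varl i f.
Proof.
rewrite /ore_terml.
have : uniq (enum 'I_n) := enum_uniq _.
have : i \in enum 'I_n by rewrite mem_enum.
elim: (enum _) => //= j r IH; rewrite inE mnm1E => /orP[/eqP<-|i_r] /andP[Ni_r r_uniq].
  rewrite eqxx /=; congr (ore_varl _ _).
  elim: r Ni_r {IH r_uniq} => //= k r IH; rewrite inE negb_or mnm1E.
  by case/andP=> /negPf-> /IH->.
have /negPf-> : i != j by apply: contraNneq Ni_r => <-.
exact: IH.
Qed.

Lemma ore_termlX t s : ore_terml t 'X_[s] = 'X_[t + s].
Proof.
rewrite {2}[t]multinomUE_id /ore_terml /index_enum -enumT.
elim: (enum _) => [|i r IH] /=; first by rewrite big_nil add0m.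
rewrite big_cons IH; elim: (t i) => [|k IHk] /=; first by rewrite mulm0n add0m.
by rewrite IHk ore_varlX mulmS addmC !addmA.
Qed.

Lemma ore_mul_widen (r : seq 'X_{1..n}) f g : uniq r -> {subset msupp f <= r} ->
  ore_mul f g = \sum_(t <- r) f@_t *: ore_terml t g.
Proof.
move=> r_uniq sfr; rewrite (bigID (mem (msupp f))) /= [X in _ + X]big1 ?addr0.
  rewrite -big_filter; apply: perm_big; apply: uniq_perm.
  - exact: msupp_uniq.
  - exact: filter_uniq.
  by move=> t; rewrite mem_filter; case: (boolP (t \in msupp f)) => // /sfr.
by move=> t /memN_msupp_eq0->; rewrite scale0r.
Qed.

Lemma ore_mulDl g : {morph ore_mul^~ g : f h / f + h}.
Proof.
move=> f h; pose r := undup (msupp f ++ msupp h ++ msupp (f + h)).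
have rU : uniq r by apply: undup_uniq.
rewrite !(@ore_mul_widen r) //; last first.
- by move=> t; rewrite mem_undup !mem_cat => ->; rewrite !orbT.
- by move=> t; rewrite mem_undup !mem_cat => ->.
- by move=> t; rewrite mem_undup !mem_cat => ->; rewrite !orbT.
rewrite -big_split; apply: eq_bigr => t _ /=.
by rewrite mcoeffD scalerDl.
Qed.

Lemma ore_mulDr f : {morph ore_mul f : g h / g + h}.
Proof.
move=> g h; rewrite /ore_mul -big_split; apply: eq_bigr => t _ /=.
by rewrite ore_termlD scalerDr.
Qed.

Lemma ore_mul0l g : ore_mul 0 g = 0.
Proof. by rewrite /ore_mul msupp0 big_nil. Qed.

Lemma ore_mul_term a t g : ore_mul (a *: 'X_[t]) g = a *: ore_terml t g.
Proof.
rewrite (@ore_mul_widen [:: t]) //.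
  by rewrite big_seq1 mcoeffZ mcoeffX eqxx mulr1.
move=> s; rewrite mcoeff_msupp mcoeffZ mcoeffX inE.
by case: (eqVneq t s) => // _; rewrite mulr0 eqxx.
Qed.

Lemma ore_mulZl a f g : ore_mul (a *: f) g = a *: ore_mul f g.
Proof.
move: f; apply: mpoly_additive_ext => [||f h|f h|b t].
- by rewrite scaler0 ore_mul0l.
- by rewrite ore_mul0l scaler0.
- by rewrite scalerDr ore_mulDl.
- by rewrite ore_mulDl scalerDr.
by rewrite scalerA !ore_mul_term scalerA.
Qed.

Lemma ore_mul_varl i g h : ore_mul (ore_varl i g) h = ore_varl i (ore_mul g h).
Proof.
move: g; apply: mpoly_additive_ext => [||f g|f g|b t].
- by rewrite ore_varl0 ore_mul0l.
- by rewrite ore_mul0l ore_varl0.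
- by rewrite ore_varlD ore_mulDl.
- by rewrite ore_mulDl ore_varlD.
rewrite ore_varlZ ore_varlX ore_mulDl !ore_mul_term ore_varlZ.
by rewrite addmC ore_terml_add ore_terml_var.
Qed.

Lemma ore_mul_terml t g h : ore_mul (ore_terml t g) h = ore_terml t (ore_mul g h).
Proof.
rewrite /ore_terml; elim: (enum _) => //= i r <-.
by elim: (t i) => //= k <-; rewrite ore_mul_varl.
Qed.

Lemma ore_mulA f g h : ore_mul f (ore_mul g h) = ore_mul (ore_mul f g) h.
Proof.
move: f; apply: mpoly_additive_ext => [||f k|f k|a t].
- by rewrite ore_mul0l.
- by rewrite !ore_mul0l.
- by rewrite ore_mulDl.
- by rewrite !ore_mulDl.
by rewrite !ore_mul_term ore_mulZl ore_mul_terml.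
Qed.

Lemma ore_mul1l f : ore_mul 1 f = f.
Proof. by rewrite -mpolyX0 -[X in ore_mul X]scale1r ore_mul_term scale1r ore_terml_id. Qed.

Lemma ore_mul1r f : ore_mul f 1 = f.
Proof.
rewrite [RHS]mpolyE; apply: eq_bigr => t _.
by rewrite -mpolyX0 ore_termlX addm0.
Qed.

HB.instance Definition _ :=
  GRing.Zmodule_isNzRing.Build (ore D)
    ore_mulA ore_mul1l ore_mul1r (fun f h g => ore_mulDl g f h) ore_mulDr
    (oner_neq0 {mpoly R[n]}).

HB.instance Definition _ :=
  GRing.Lmodule_isLalgebra.Build R (ore D) (fun a f g => esym (ore_mulZl a f g)).

(** The monomial [a * t] of the Ore extension. *)
Definition mono a t : ore D := a *: 'X_[R, t].

(** The next lemmas show that [ore D] is the iterated Ore extension. *)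

Lemma ore_constM a (g : ore D) : mono a 0%MM * g = a *: g.
Proof. by rewrite [LHS]ore_mul_term ore_terml_id. Qed.

Lemma ore_termM t s : mono 1 t * mono 1 s = mono 1 (t + s)%MM.
Proof. by rewrite [LHS]ore_mul_term /mono !scale1r ore_termlX. Qed.

Lemma ore_mulX (f : ore D) i :
  f * mono 1 U_(i)%MM = (f : {mpoly R[n]}) * 'X_i :> {mpoly R[n]}.
Proof.
rewrite [in RHS](mpolyE f) mulr_suml; apply: eq_bigr => t _.
by rewrite /mono scale1r ore_termlX -scalerAl mpolyXD.
Qed.

Lemma ore_varM i (f : ore D) :
  mono 1 U_(i)%MM * f = (ahat i f : ore D) * mono 1 U_(i)%MM + dhat i f.
Proof. by rewrite ore_mulX [LHS]ore_mul_term scale1r ore_terml_var. Qed.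

Lemma ore_varC i a :
  mono 1 U_(i)%MM * mono a 0%MM =
  mono (alpha D i a) U_(i)%MM + mono (delta D i a) 0%MM.
Proof.
rewrite [LHS]ore_mul_term scale1r ore_terml_var ore_varlZ ore_varlX.
by rewrite /mono add0m.
Qed.

(** [f] belongs to the subring generated by R and the [Y_i], [i != j]. *)
Definition free_of j f := forall t, t \in msupp f -> t j = 0%N.

Lemma free_of_ind j (P : {mpoly R[n]} -> Prop) :
  (forall a t, t j = 0%N -> P (a *: 'X_[t])) ->
  P 0 -> (forall f g, P f -> P g -> P (f + g)) ->
  forall f, free_of j f -> P f.
Proof.
move=> Pm P0 PD f jf; rewrite [f]mpolyE big_seq.
by elim/big_ind: _ => // t /jf; apply: Pm.
Qed.

Lemma terml_comm (F : {mpoly R[n]} -> {mpoly R[n]}) j t f : t j = 0%N ->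
  (forall i h, i != j -> F (ore_varl i h) = ore_varl i (F h)) ->
  F (ore_terml t f) = ore_terml t (F f).
Proof.
move=> tj FC; rewrite /ore_terml; elim: (enum _) => //= i r <-.
have [->|neq_ij] := eqVneq i j; first by rewrite tj.
by elim: (t i) => //= k <-; rewrite FC.
Qed.

Lemma ahat_varl i j f : i != j -> ahat j (ore_varl i f) = ore_varl i (ahat j f).
Proof.
move=> neq_ij; move: f.
apply: mpoly_additive_ext => [||f h|f h|a t]; rewrite ?(raddf0, ore_varl0) //.
- by rewrite ore_varlD raddfD.
- by rewrite raddfD ore_varlD.
rewrite ore_varlZ ore_varlX raddfD /= !ahatZ !ahatX ore_varlZ ore_varlX.
by rewrite alphaC alpha_deltaC.
Qed.

Lemma dhat_varl i j f : i != j -> dhat j (ore_varl i f) = ore_varl i (dhat j f).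
Proof.
move=> neq_ij; move: f.
apply: mpoly_additive_ext => [||f h|f h|a t]; rewrite ?(raddf0, ore_varl0) //.
- by rewrite ore_varlD raddfD.
- by rewrite raddfD ore_varlD.
rewrite ore_varlZ ore_varlX raddfD /= !dhatZ !dhatX !scaler0 !add0r.
by rewrite ore_varlZ ore_varlX deltaC alpha_deltaC // eq_sym.
Qed.

Lemma ahatM j (f g : ore D) : free_of j f ->
  ahat j (f * g) = (ahat j f : ore D) * ahat j g.
Proof.
elim/free_of_ind => [a t tj||f1 f2 IH1 IH2].
- rewrite ahatZ ahatX [in LHS]/GRing.mul [in RHS]/GRing.mul /= !ore_mul_term.
  by rewrite ahatZ (@terml_comm (ahat j) j t) // => i h; exact: ahat_varl.
- by rewrite mul0r !raddf0 mul0r.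
by rewrite mulrDl !raddfD /= mulrDl IH1 IH2.
Qed.

Lemma dhatM j (f g : ore D) : free_of j f ->
  dhat j (f * g) = (ahat j f : ore D) * dhat j g + (dhat j f : ore D) * g.
Proof.
elim/free_of_ind => [a t tj||f1 f2 IH1 IH2].
- rewrite ahatZ ahatX dhatZ dhatX scaler0 add0r.
  rewrite [in LHS]/GRing.mul [X in X + _]ore_mul_term [X in _ + X]ore_mul_term.
  by rewrite /= ore_mul_term dhatZ (@terml_comm (dhat j) j t) // => i h; apply: dhat_varl.
- by rewrite !mul0r !raddf0 !mul0r addr0.
by rewrite mulrDl !raddfD /= !mulrDl IH1 IH2 addrACA.
Qed.

End OreRing.

(** The associated graded Ore extension is the Ore extension with the same
    [alpha_i] and zero derivations; it has the same underlying module. *)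
Program Definition graded n R (D : ore_data n R) : ore_data n R :=
  @OreData n R (alpha D) (fun _ => \0) (@alpha_inj _ _ D) _ (@alphaC _ _ D) _ _.
Next Obligation. by rewrite mulr0 mul0r addr0. Qed.
Next Obligation. by rewrite raddf0. Qed.

Lemma graded_mulE n R (D : ore_data n R) a b t s :
  mono (graded D) a t * mono (graded D) b s =
  mono (graded D) (a * alpha_term D t b) (t + s)%MM.
Proof.
rewrite [LHS]ore_mul_term /mono -scalerA; congr (_ *: _).
rewrite -(ore_termlX (graded D)) /ore_terml /alpha_term.
elim: (enum _) => //= i r ->.
elim: (t i) => //= k ->; rewrite ore_varlZ /= scale0r addr0 //.
Qed.

(** * Term orderings, leading terms *)

Section Terms.
Context (n m : nat).

(** The term [t e_i] of the free module is the pair [(t, i)]. *)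
Definition term : Type := ('X_{1..n} * 'I_m)%type.

Definition tmul (w : 'X_{1..n}) (t : term) : term := ((w + t.1)%MM, t.2).

Definition strict_well_order (T : Type) (lt : rel T) : Prop :=
  [/\ transitive lt,
      forall x y, x = y \/ lt x y \/ lt y x
    & well_founded (fun x y => lt x y)].

Definition term_order (ltT : rel 'X_{1..n}) : Prop :=
  strict_well_order ltT /\
  forall w t1 t2, ltT t1 t2 -> ltT (w + t1)%MM (w + t2)%MM.

Definition compatible_term_order (ltT : rel 'X_{1..n}) (lt : rel term) : Prop :=
  [/\ strict_well_order lt,
      forall w1 w2 t, ltT w1 w2 -> lt (tmul w1 t) (tmul w2 t)
    & forall w t1 t2, lt t1 t2 -> lt (tmul w t1) (tmul w t2)].

Context (R : nzRingType) (D : ore_data n R) (lt : rel term).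
Implicit Types f : 'rV[ore D]_m.

Definition coefT f (t : term) : R := mcoeff t.1 (f 0 t.2).

Definition suppT f : seq term :=
  flatten [seq [seq (t, i) | t <- msupp (f 0 i)] | i <- enum 'I_m].

(** The maximal term [T(f)], which is undefined ([None]) exactly when f = 0. *)
Definition lterm f : option term :=
  foldr (fun t o => if o is Some s then Some (if lt s t then t else s)
                    else Some t) None (suppT f).

Definition lcoef f : R := if lterm f is Some t then coefT f t else 0.

(** The maximal monomial [M(f) = lc(f) T(f)], as an element of the graded
    module. *)
Definition lmon f : 'rV[ore (graded D)]_m :=
  if lterm f is Some t then mono (graded D) (lcoef f) t.1 *: delta_mx 0 t.2
  else 0.

Definition le_oterm (o1 o2 : option term) : bool :=
  if (o1, o2) is (Some t1, Some t2) then (t1 == t2) || lt t1 t2 else false.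

Lemma mem_suppT f t : (t \in suppT f) = (coefT f t != 0).
Proof.
case: t => t i; rewrite /coefT /= -mcoeff_msupp.
apply/flatten_mapP/idP => [[j _ /mapP[s sj [-> ->]]] //|ti].
by exists i; rewrite ?mem_enum //; apply/mapP; exists t.
Qed.

Lemma ltermP f t : strict_well_order lt ->
  lterm f = Some t <->
  (coefT f t != 0 /\ forall s, coefT f s != 0 -> s = t \/ lt s t).
Proof.
case=> lt_tr lt_tot lt_wf.
have lt_irr x : ~~ lt x x.
  by elim: (lt_wf x) => y _ IH; apply/negP => yy; case/negP: (IH y yy).
have max_fold r : forall x, foldr (fun t o => if o is Some s then
    Some (if lt s t then t else s) else Some t) None r = Some x ->
    x \in r /\ forall s, s \in r -> s = x \/ lt s x.
  elim: r => //= y r IH x.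
  case E: (foldr _ _ _) => [z|] [<-]; last first.
    rewrite inE eqxx; split=> // s; rewrite inE => /orP[/eqP|]; first by left.
    by case: r E {IH} => //= w r; case: (foldr _ _ _).
  have [zr zmax] := IH _ E; case: ifP => [zy|Nzy].
    rewrite inE eqxx; split=> // s; rewrite inE => /orP[/eqP|/zmax]; first by left.
    by case=> [->|sz]; right => //; apply: lt_tr zy.
  rewrite inE zr orbT; split=> // s; rewrite inE => /orP[/eqP->|/zmax //].
  by case: (lt_tot y z) => [|[]]; [left|right|rewrite Nzy].
split=> [/max_fold[]|[ft tmax]].
  by rewrite mem_suppT => ft H; split=> // s; rewrite -mem_suppT => /H.
case E: (lterm f) => [x|].
  have [fx xmax] := max_fold _ _ E; congr Some.
  case: (tmax x); rewrite -?mem_suppT // => xt.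
  case: (xmax t); rewrite ?mem_suppT // => tx.
  by case/negP: (lt_irr x); apply: lt_tr tx.
move: ft; rewrite -mem_suppT; move: E; rewrite /lterm.
by case: (suppT f) => //= y r; case: (foldr _ _ _).
Qed.

End Terms.

(** * Groebner notions *)

(** The left submodule generated by [B]. *)
Definition lspan (A : nzRingType) (V : lmodType A) (B : V -> Prop) (v : V) : Prop :=
  exists2 s : seq (A * V),
    forall x, x \in s -> B x.2 & v = \sum_(x <- s) x.1 *: x.2.

Section Groebner.
Context (n m u : nat) (R : nzRingType) (D : ore_data n R) (lt : rel (term n m)).
Context (g : 'I_u -> 'rV[ore D]_m).

(** A finite sum [sum_i a_i lambda_i g_(j_i)] is encoded by the list of the
    triples [(a_i, lambda_i, j_i)]. *)
Implicit Type s : seq (R * 'X_{1..n} * 'I_u).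

Definition left_ideal_gen (f : 'rV[ore D]_m) : Prop :=
  lspan (fun v => exists i, v = g i) f.

Definition left_groebner_basis : Prop :=
  forall f, left_ideal_gen f -> f != 0 ->
  exists2 s,
    forall a w j, (a, w, j) \in s ->
      a != 0 /\ omap (tmul w) (lterm lt (g j)) = lterm lt f
  & lmon lt f = \sum_(x <- s) mono (graded D) x.1.1 x.1.2 *: lmon lt (g x.2).

Definition left_weak_groebner_rep (f : 'rV[ore D]_m) : Prop :=
  exists2 s,
    forall a w j, (a, w, j) \in s ->
      a != 0 /\ le_oterm lt (omap (tmul w) (lterm lt (g j))) (lterm lt f)
  & f = \sum_(x <- s) mono D x.1.1 x.1.2 *: g x.2.

Definition sL (h : 'rV[ore (graded D)]_u) : 'rV[ore (graded D)]_m :=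
  \sum_i h 0 i *: lmon lt (g i).

Definition term_homogeneous (h : 'rV[ore (graded D)]_u) : Prop :=
  exists (a : 'I_u -> R) (w : 'I_u -> 'X_{1..n}),
    h = \sum_i mono (graded D) (a i) (w i) *: delta_mx 0 i /\
    forall i j, a i != 0 -> a j != 0 ->
      omap (tmul (w i)) (lterm lt (g i)) = omap (tmul (w j)) (lterm lt (g j)).

Definition left_gebauer_moeller_set (B : 'rV[ore (graded D)]_u -> Prop) : Prop :=
  (forall b, B b -> term_homogeneous b) /\
  forall h, lspan B h <-> sL h = 0.

End Groebner.

(** * Zacharias rings, principal ideal domains *)

Definition left_ideal (R : nzRingType) (I : R -> Prop) : Prop :=
  [/\ I 0, forall x y, I x -> I y -> I (x + y) & forall a x, I x -> I (a * x)].

Definition left_noetherian (R : nzRingType) : Prop :=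
  forall I : R -> Prop, left_ideal I ->
  exists (k : nat) (G : 'I_k -> R),
    forall x, I x <-> exists d : 'I_k -> R, x = \sum_i d i * G i.

(** [R^c] is the opposite ring. *)
Definition noetherian (R : nzRingType) : Prop :=
  left_noetherian R /\ left_noetherian R^c.

(** The algorithms are data: an algorithm is a function in Type.  The vectors
    c_1, ..., c_t are the rows of C, so that [d *m C = sum_i d_i c_i]. *)
Record left_zacharias (R : nzRingType) : Type := LeftZacharias {
  zacharias_noetherian : noetherian R;
  zacharias_membership : forall (k t : nat) (c : 'rV[R]_k) (C : 'M[R]_(t, k)),
    (forall i, row i C != 0) ->
    {d : 'rV[R]_t | c = d *m C} + {~ exists d : 'rV[R]_t, c = d *m C};
  zacharias_syzygies : forall (k t : nat) (C : 'M[R]_(t, k)),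
    (forall i, row i C != 0) ->
    {r : nat & {S : 'M[R]_(r, t) | forall d : 'rV[R]_t,
      d *m C = 0 <-> exists e : 'rV[R]_r, d = e *m S}}
}.

Definition principal_ideal_domain (R : idomainType) : Prop :=
  forall I : R -> Prop, left_ideal I ->
  exists a, forall x, I x <-> exists q, x = q * a.

Definition divides (R : comNzRingType) (a b : R) : Prop := exists q, b = q * a.

Definition is_lcm (R : comNzRingType) (a b c : R) : Prop :=
  [/\ divides a c, divides b c
    & forall d, divides a d -> divides b d -> divides c d].

(** The quotient [c / a] in a domain, when [a] is nonzero and divides [c]. *)
Definition exact_div (R : comNzRingType) (c a : R) : R :=
  epsilon (inhabits 0) (fun q => c = q * a).

(** * The elements b(i,j) and B(i,j) *)

Section Pairs.
Context (n m u : nat) (R : idomainType) (D : ore_data n R).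
Context (g : 'I_u -> 'rV[ore D]_m).
Context (c : 'I_u -> R) (tau : 'I_u -> 'X_{1..n}) (cc : 'I_u -> 'I_u -> R).

Definition tau_lcm i j : 'X_{1..n} := mlcm (tau i) (tau j).

(** [a_ij = alpha_(tau(i,j)/tau_i) (c_i)] *)
Definition acoef i j : R := alpha_term D (tau_lcm i j - tau i)%MM (c i).

Definition bsyz i j : 'rV[ore (graded D)]_u :=
  mono (graded D) (exact_div (cc i j) (acoef j i)) (tau_lcm i j - tau j)%MM
    *: delta_mx 0 j
  - mono (graded D) (exact_div (cc i j) (acoef i j)) (tau_lcm i j - tau i)%MM
    *: delta_mx 0 i.

Definition Spoly i j : 'rV[ore D]_m :=
  mono D (exact_div (cc i j) (acoef j i)) (tau_lcm i j - tau j)%MM *: g j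
  - mono D (exact_div (cc i j) (acoef i j)) (tau_lcm i j - tau i)%MM *: g i.

End Pairs.

(* Main.v *)
(** Splitting a syzygy of the leading monomials into its homogeneous components
    of degree [t = s e_k] turns it into a syzygy [sum a_i alpha_(s/tau_i)(c_i) = 0]
    over R.  In a principal ideal domain such syzygies are generated by those
    involving only two indices: if [a_p d_p] lies in the ideal [(G)] of the other
    [d_i], then a Bezout relation for [G] splits [a_p d_p] into common multiples of
    [d_p] and the [d_i].  As [alpha_w] is an automorphism it preserves least common
    multiples, so a two-term syzygy of degree [t] is a multiple of [b(i,j)].
    Buchberger's criterion follows: a representation of [f] whose terms of maximal
    degree [t] cancel is rewritten, through the [B(i,j)], with terms below [t],
    and the term ordering is well founded. *)
Require Import Defs.
From Stdlib Require Import ClassicalEpsilon.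
From mathcomp Require Import all_boot all_order all_algebra ring.
Import GRing.Theory.
Local Open Scope ring_scope.

Set Implicit Arguments.
Unset Strict Implicit.
Unset Printing Implicit Defensive.

(** * Syzygies over a principal ideal domain *)

(** The [d i] with [i] in [A] generate an ideal [(G)] with a Bezout relation [G = sum e_i d_i]. If
    the given sum is [w G], take [b_i = w e_i]: since [d_i] is a multiple of [G], each [b_i d_i] is
    a multiple of [w G], hence of [z]. *)
Lemma multiple_sum_split (R : idomainType) (u : nat) (A : pred 'I_u)
    (a d : 'I_u -> R) (z : R) :
  principal_ideal_domain R ->
  divides z (\sum_(i | A i) a i * d i) ->
  exists b : 'I_u -> R, \sum_(i | A i) a i * d i = \sum_(i | A i) b i * d i /\
    forall i, divides z (b i * d i).
Proof.
move=> pid [y zE].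
have [|G GP] := pid (fun x => exists e, x = \sum_(i | A i) e i * d i).
  split.
  - by exists (fun=> 0); rewrite big1 // => i _; rewrite mul0r.
  - move=> _ _ [e1 ->] [e2 ->]; exists (fun i => e1 i + e2 i).
    by rewrite -big_split; apply: eq_bigr => i _; rewrite mulrDl.
  - move=> q _ [e ->]; exists (fun i => q * e i).
    by rewrite mulr_sumr; apply: eq_bigr => i _; rewrite mulrA.
have [e GE] : exists e, G = \sum_(i | A i) e i * d i.
  by apply/GP; exists 1; rewrite mul1r.
have [w wE] : exists q, \sum_(i | A i) a i * d i = q * G by apply/GP; exists a.
exists (fun i => if A i then w * e i else 0); split.
  rewrite wE GE mulr_sumr; apply: eq_bigr => i Ai.
  by rewrite Ai mulrA.
move=> i; case: ifP => [Ai|_]; last by exists 0; rewrite !mul0r.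
have [x dE] : exists q, d i = q * G.
  apply/GP; exists (fun j => (j == i)%:R).
  rewrite (bigD1 i) //= eqxx mul1r big1 ?addr0 // => j /andP[_ /negPf->].
  by rewrite mul0r.
exists (x * e i * y).
by rewrite -[RHS]mulrA -zE wE {1}dE; ring.
Qed.

(** Generation of syzygies by those with two indices, phrased as an induction principle. The proof
    is by induction on a bound for the support of [a], whose top index is cleared by two-index
    syzygies. *)
Lemma syzygy_pairwise_ind (R : idomainType) (u : nat) (A : pred 'I_u)
    (d : 'I_u -> R) (P : 'rV[R]_u -> Prop) :
  principal_ideal_domain R -> (forall i, A i -> d i != 0) ->
  P 0 -> (forall v w, P v -> P w -> P (v + w)) ->
  (forall (i j : 'I_u) x y, (i < j)%N -> A i -> A j -> x * d j = y * d i ->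
     P (x *: delta_mx 0 j - y *: delta_mx 0 i)) ->
  forall a : 'rV[R]_u, (forall i, ~~ A i -> a 0 i = 0) ->
  \sum_i a 0 i * d i = 0 -> P a.
Proof.
move=> pid d_neq0 P0 PD Ppair a aA ad0.
have [k ku ak] : exists2 k, (k <= u)%N & forall i : 'I_u, (k <= i)%N -> a 0 i = 0.
  by exists u => // i; rewrite leqNgt ltn_ord.
elim: k a ku aA ad0 ak => [|k IH] a ku aA ad0 ak.
  suff -> : a = 0 by [].
  by apply/rowP=> i; rewrite mxE ak.
pose p := Ordinal ku.
have [Ap|NAp] := boolP (A p); last first.
  apply: IH => // [|i]; first exact: ltnW.
  rewrite leq_eqVlt => /orP[/eqP ki|]; last exact: ak.
  by rewrite -(aA p NAp); congr (a 0 _); apply: val_inj.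
pose B (i : 'I_u) := (i < k)%N && A i.
have adE : \sum_i a 0 i * d i = a 0 p * d p + \sum_(i | B i) a 0 i * d i.
  rewrite (bigD1 p) //=; congr (_ + _); rewrite (bigID B) /= [X in _ + X]big1.
    rewrite addr0; apply: eq_bigl => i; rewrite /B.
    by have [->|] := eqVneq i p; rewrite /= ?ltnn.
  move=> i /andP[Nip]; rewrite /B negb_and -leqNgt => /orP[|/aA ->]; last exact: mul0r.
  rewrite leq_eqVlt => /orP[/eqP ki|/ak ->]; last by rewrite mul0r.
  by case/eqP: Nip; apply: val_inj.
have adp : \sum_(i | B i) - a 0 i * d i = a 0 p * d p.
  apply/eqP; rewrite eq_sym -subr_eq0 -sumrN; apply/eqP; rewrite -[RHS]ad0 adE; congr (_ + _).
  by apply: eq_bigr => i _; rewrite mulNr opprK.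
(* The multiple [a_p d_p] of [d_p] lies in the ideal of the earlier [d_i], so it splits into common
   multiples [b_i d_i = x_i d_p]. *)
have [|b [bE db]] := @multiple_sum_split R u B (fun i => - a 0 i) d (d p) pid.
  by exists (a 0 p).
have [x xE] := fin_all_exists db.
(* A sum of two-index syzygies. Cancelling [d_p] shows that the [x_i] add up to [a 0 p], so [a - w]
   vanishes from [p] on. *)
pose w := \sum_(i | B i) (x i *: delta_mx 0 p - b i *: delta_mx 0 i) : 'rV[R]_u.
have wE i : w 0 i = (i == p)%:R * (\sum_(i | B i) x i) - (B i)%:R * b i.
  rewrite summxE (eq_bigr (fun j => (i == p)%:R * x j - (i == j)%:R * b j)).
    rewrite big_split sumrN -mulr_sumr /=; congr (_ - _).
    have [Bi|NBi] := boolP (B i); last first.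
      rewrite mul0r big1 // => j Bj; case: eqP NBi Bj => [->|]; rewrite ?mul0r //.
      by move=> /negPf->.
    rewrite (bigD1 i) //= eqxx big1 ?addr0 // => j /andP[_].
    by rewrite eq_sym => /negPf->; rewrite mul0r.
  by move=> j _; rewrite !mxE eqxx /= mulrC [b j * _]mulrC.
have Pw : P w.
  apply: (big_ind P) => // i /andP[ik Ai]; exact: Ppair.
have axp : a 0 p = \sum_(i | B i) x i.
  apply: (mulIf (d_neq0 p Ap)); rewrite -adp bE mulr_suml.
  by apply: eq_bigr => i _.
rewrite -(subrK w a); apply: PD => //; apply: IH; first exact: ltnW.
- move=> i NAi; rewrite !mxE wE aA // /B (negPf NAi) andbF mul0r subr0 sub0r.
  by case: eqP NAi Ap => [-> /negPf->|] //; rewrite mul0r oppr0.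
- rewrite (eq_bigr (fun i => a 0 i * d i - w 0 i * d i)); last first.
    by move=> i _; rewrite !mxE mulrBl.
  rewrite big_split /= ad0 add0r sumrN; apply/eqP; rewrite oppr_eq0; apply/eqP.
  rewrite (eq_bigr (fun i => (i == p)%:R * (a 0 p * d p) - (B i)%:R * (b i * d i))).
    rewrite big_split /= sumrN -mulr_suml (bigD1 p) //= eqxx big1.
      rewrite addr0 mul1r -adp bE [X in X - _]big_mkcond -sumrB big1 // => i _ /=.
      by case: ifP; rewrite ?mul1r ?mul0r subrr.
    by move=> i /negPf->.
  by move=> i _; rewrite wE -axp; have [->|_] := eqVneq i p; rewrite /=; ring.
move=> i; rewrite leq_eqVlt !mxE wE -axp => /orP[/eqP ki|ki].
  have -> : i = p by apply: val_inj.
  by rewrite eqxx /B ltnn /=; ring.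
have /negPf-> : i != p by rewrite -val_eqE /= gtn_eqF.
have /negPf-> : ~~ B i by rewrite /B negb_and -leqNgt (ltnW ki).
by rewrite (ak i ki) !mul0r !subr0.
Qed.

(** * Leading terms of products in an Ore extension *)

Lemma mnm_ind (n : nat) (Q : 'X_{1..n} -> Prop) :
  Q 0%MM -> (forall i w, Q w -> Q (U_(i) + w)%MM) -> forall w, Q w.
Proof.
move=> Q0 QS w; have [k] := ubnP (mdeg w); elim: k w => // k IH w.
have [->//|w_neq0] := eqVneq w 0%MM.
have [i wi] : exists i, w i != 0%N.
  apply/existsP; rewrite -negb_forall; apply: contra w_neq0 => /forallP w0.
  by apply/eqP/mnmP=> i; rewrite mnm0E; apply/eqP.
have Uw : (U_(i) <= w)%MM.
  by apply/mnm_lepP=> j; rewrite mnm1E; case: eqP => //= <-; rewrite lt0n.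
by rewrite -(submK Uw) addmC mdegD mdeg1 ltnS => /IH; apply: QS.
Qed.

(** Irreflexivity is not a clause of [strict_well_order]; it comes from well-foundedness. *)
Lemma lt_irrefl (T : Type) (lt : rel T) x : strict_well_order lt -> lt x x = false.
Proof.
case=> _ _ wf; elim: (wf x) => y _ IH; apply/negP => yy.
by move: (IH y yy); rewrite yy.
Qed.

Section AlphaTerm.
Context (n : nat) (R : nzRingType) (D : ore_data n R).
Implicit Types (v w : 'X_{1..n}) (a b : R).

Lemma alpha_term0 a : alpha_term D 0%MM a = a.
Proof.
by rewrite /alpha_term; elim: (enum _) => //= i r ->; rewrite mnm0E.
Qed.

(** Read off from associativity in the graded extension: both sides are the coefficient of [Y^(v+w)]
    in [Y^v Y^w a]. *)
Lemma alpha_termD v w a : alpha_term D (v + w) a = alpha_term D v (alpha_term D w a).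
Proof.
have := graded_mulE D 1 a (v + w) 0; rewrite mul1r addm0.
have -> : mono (graded D) 1 (v + w) = mono (graded D) 1 v * mono (graded D) 1 w.
  by rewrite ore_termM.
rewrite -mulrA !graded_mulE !mul1r addm0 => /(congr1 (mcoeff (v + w))).
by rewrite /mono !mcoeffZ !mcoeffX eqxx !mulr1 => ->.
Qed.

Lemma alpha_termS i w a : alpha_term D (U_(i) + w) a = alpha D i (alpha_term D w a).
Proof.
rewrite alpha_termD; move: (alpha_term D w a) => b.
have := graded_mulE D 1 b U_(i) 0; rewrite mul1r ore_varC /mono scale0r addr0 addm0.
move=> /(congr1 (mcoeff U_(i))).
by rewrite !mcoeffZ !mcoeffX eqxx !mulr1 => ->.
Qed.

Lemma alpha_termM w : {morph alpha_term D w : a b / a * b}.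
Proof.
move=> a b; elim/mnm_ind: w => [|i w IH]; first by rewrite !alpha_term0.
by rewrite !alpha_termS IH rmorphM.
Qed.

Lemma alpha_term_inj w : injective (alpha_term D w).
Proof.
elim/mnm_ind: w => [|i w IH] a b; first by rewrite !alpha_term0.
by rewrite !alpha_termS => /alpha_inj /IH.
Qed.

Lemma alpha_term_r0 w : alpha_term D w 0 = 0.
Proof.
elim/mnm_ind: w => [|i w IH]; first by rewrite alpha_term0.
by rewrite alpha_termS IH rmorph0.
Qed.

Lemma alpha_term_eq0 w a : (alpha_term D w a == 0) = (a == 0).
Proof. by rewrite -[RHS](inj_eq (@alpha_term_inj w)) alpha_term_r0. Qed.

Lemma alpha_term_surj w b :
  (forall i, bijective (alpha D i)) -> exists a, b = alpha_term D w a.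
Proof.
move=> bij; elim/mnm_ind: w b => [|i w IH] b; first by exists b; rewrite alpha_term0.
have [f _ fK] := bij i; have [a fbE] := IH (f b).
by exists a; rewrite alpha_termS -fbE fK.
Qed.

(* [Q w] bounds the support of [Y^w * p]; it is instantiated below by both
   orderings, the one on terms and the one on module terms. *)
Context (Q : 'X_{1..n} -> pred 'X_{1..n}).
Hypothesis Q_shift : forall w i s, Q w s -> Q (U_(i) + w)%MM (U_(i) + s)%MM.
Hypothesis Q_weaken : forall w i s, Q w s -> Q (U_(i) + w)%MM s.

Lemma coef_ore_varl i (p : {mpoly R[n]}) s :
  (ore_varl D i p)@_s =
  (if (U_(i) <= s)%MM then alpha D i p@_(s - U_(i)) else 0) + delta D i p@_s.
Proof.
rewrite mcoeffD !mcoeff_map_mpoly; congr (_ + _).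
case: ifP => [Us|NUs].
  by rewrite -{1}(submK Us) addmC mcoeffMX mcoeff_map_mpoly.
rewrite mcoeffMr big1 // => /= m /eqP sE; rewrite mcoeffX.
case: eqP => [Ui|_]; last by rewrite mulr0.
by have := lem_addr m.1 m.2; rewrite -sE -Ui NUs.
Qed.

(** A coefficient of [Y_i * p] at [s] comes from [s - U_i] through [alpha_i], covered by [Q_shift],
    or from [s] through [delta_i], covered by [Q_weaken]. *)
Lemma ore_terml_supp w (p : {mpoly R[n]}) :
  (forall s, p@_s != 0 -> Q 0%MM s) ->
  forall s, (ore_terml D w p)@_s != 0 -> Q w s.
Proof.
move=> Qp; elim/mnm_ind: w => [|i w IH] s; first by rewrite ore_terml_id; exact: Qp.
rewrite ore_terml_add ore_terml_var coef_ore_varl.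
have [/IH|/negbNE/eqP->] := boolP ((ore_terml D w p)@_s != 0).
  by move=> Qs _; apply: Q_weaken.
rewrite raddf0 addr0; case: ifP => [Us|_]; last by rewrite eqxx.
move=> nz; have -> : s = (U_(i) + (s - U_(i)))%MM by rewrite addmC submK.
apply/Q_shift/IH; by apply: contraNneq nz => ->; rewrite rmorph0.
Qed.

(** At each step the derivation would contribute only through the coefficient at [U_i + w + v],
    which the support bound excludes; only the [alpha_i] remain. *)
Lemma ore_terml_top v w (p : {mpoly R[n]}) :
  (forall s, p@_s != 0 -> Q 0%MM s) -> (forall w i, ~~ Q w (U_(i) + (w + v))%MM) ->
  (ore_terml D w p)@_(w + v) = alpha_term D w p@_v.
Proof.
move=> Qp NQ; elim/mnm_ind: w => [|i w IH].
  by rewrite ore_terml_id add0m alpha_term0.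
rewrite ore_terml_add ore_terml_var coef_ore_varl -addmA lem_addr alpha_termS -IH.
rewrite addmC addmK; have [/(ore_terml_supp Qp)|/negbNE/eqP->] :=
  boolP ((ore_terml D w p)@_(w + v + U_(i)) != 0).
  by rewrite addmC; move/negP: (NQ w i).
by rewrite raddf0 addr0.
Qed.

End AlphaTerm.

Section LeadingTerms.
Context (n m : nat) (ltT : rel 'X_{1..n}) (lt : rel (term n m)).
Hypotheses (hltT : term_order ltT) (hlt : compatible_term_order ltT lt).
Implicit Types (v w : 'X_{1..n}) (t : term n m).

Definition le_term (s t : term n m) := (s == t) || lt s t.

Lemma lt_wf : strict_well_order lt. Proof. by case: hlt. Qed.

Lemma lt_le_term_trans s t r : lt s t -> le_term t r -> lt s r.
Proof. by case: lt_wf => tr _ _ st /orP[/eqP<-//|]; apply: tr. Qed.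

Lemma le_lt_term_trans s t r : le_term s t -> lt t r -> lt s r.
Proof. by case: lt_wf => tr _ _ /orP[/eqP->//|]; apply: tr. Qed.

Lemma le_term_total s t : le_term s t \/ lt t s.
Proof.
by case: lt_wf => _ tot _; rewrite /le_term; case: (tot s t) => [->|[->|->]];
  rewrite ?eqxx ?orbT; auto.
Qed.

Lemma tmul_le w s t : le_term s t -> le_term (tmul w s) (tmul w t).
Proof.
case: hlt => _ _ tm /orP[/eqP->|st]; rewrite /le_term ?eqxx // tm ?orbT //.
Qed.

(** If a term [x] were below 1, then [x^2 < x], and repeated squaring would descend forever. *)
Lemma ltT_var i w : ltT w (U_(i) + w)%MM.
Proof.
have [[tr tot wf] addT] := hltT.
rewrite -{1}[w]addm0 [(U_(i) + w)%MM]addmC; apply: (addT w).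
case: (tot 0%MM U_(i)%MM) => [U0|[//|neg]].
  by have := mnm1_eq0 i; rewrite -U0 eqxx.
suff no x : ~ ltT x 0%MM by case: (no U_(i)%MM).
elim: (wf x) => {}x _ IH x0; have xx : ltT (x + x)%MM x.
  by have := addT x _ _ x0; rewrite addm0.
by apply: (IH _ xx); apply: tr xx x0.
Qed.

Lemma lt_tmul_var i t : lt t (tmul U_(i)%MM t).
Proof.
case: hlt => _ mulT _; have := mulT _ _ t (ltT_var i 0%MM).
by case: t => t k; rewrite /tmul /= add0m addm0.
Qed.

(** The products of the Ore extension and of its graded extension agree on monomials up to strictly
    smaller terms. Here [Q] bounds the support of [Y^w * b Y^v] by [Y^(w+v)]. *)
Lemma ore_mono_mul (R : nzRingType) (D : ore_data n R) a b w v :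
  exists2 p : ore D, mono D a w * mono D b v = mono D (a * alpha_term D w b) (w + v) + p
    & forall s : 'X_{1..n}, mcoeff s p != 0 -> ltT s (w + v)%MM.
Proof.
have [[tr tot wf] addT] := hltT.
pose Q w (s : 'X_{1..n}) := (s == w + v)%MM || ltT s (w + v)%MM.
have Qshift w' i s : Q w' s -> Q (U_(i) + w')%MM (U_(i) + s)%MM.
  by rewrite /Q -addmA => /orP[/eqP->|/(addT U_(i)%MM)->]; rewrite ?eqxx ?orbT.
have Qweaken w' i s : Q w' s -> Q (U_(i) + w')%MM s.
  rewrite /Q -addmA => /orP[/eqP->|sw]; first by rewrite ltT_var orbT.
  by rewrite (tr _ _ _ sw) ?orbT // ltT_var.
have Q0 s : (b *: 'X_[v] : {mpoly R[n]})@_s != 0 -> Q 0%MM s.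
  rewrite mcoeffZ mcoeffX /Q add0m [s == v]eq_sym.
  by have [//|] := eqVneq v s; rewrite mulr0 eqxx.
have NQ w' i : ~~ Q w' (U_(i) + (w' + v))%MM.
  rewrite /Q; have lti := ltT_var i (w' + v)%MM; rewrite negb_or.
  have irr x := lt_irrefl x (proj1 hltT).
  apply/andP; split; first by apply/eqP=> E; move: (irr (w' + v)%MM); rewrite -{2}E lti.
  by apply/negP => /(tr _ _ _ lti); rewrite irr.
exists (mono D a w * mono D b v - mono D (a * alpha_term D w b) (w + v)).
  by rewrite addrC subrK.
have -> : mono D a w * mono D b v = a *: ore_terml D w (b *: 'X_[v]).
  exact: ore_mul_term.
move=> s; rewrite mcoeffB !mcoeffZ mcoeffX.
have [<-|sE] := eqVneq (w + v)%MM s.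
  rewrite (@ore_terml_top _ _ D Q Qshift Qweaken v w _ Q0 NQ).
  by rewrite mcoeffZ mcoeffX !eqxx !mulr1 subrr eqxx.
rewrite mulr0 subr0 => nz; have := @ore_terml_supp _ _ D Q Qshift Qweaken w _ Q0 s.
rewrite /Q [s == _]eq_sym (negPf sE) /=; apply.
by apply: contraNneq nz => ->; rewrite mulr0.
Qed.

Section Module.
Context (R : nzRingType) (D : ore_data n R).
Implicit Types f h : 'rV[ore D]_m.

Lemma coefTD t : {morph (@coefT n m R D)^~ t : f h / f + h}.
Proof. by move=> f h; rewrite /coefT mxE mcoeffD. Qed.

Lemma coefT0 t : coefT (0 : 'rV[ore D]_m) t = 0.
Proof. by rewrite /coefT mxE mcoeff0. Qed.

Lemma coefTN f t : coefT (- f) t = - coefT f t.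
Proof. by rewrite /coefT mxE mcoeffN. Qed.

Lemma coefT_sum I (r : seq I) (F : I -> 'rV[ore D]_m) t :
  coefT (\sum_(x <- r) F x) t = \sum_(x <- r) coefT (F x) t.
Proof. exact: (big_morph (fun f => coefT f t) (coefTD t) (coefT0 t)). Qed.

Lemma coefT_neq0 f : f != 0 -> exists t, coefT f t != 0.
Proof.
case E: (suppT f) => [|t r] f0; last by exists t; rewrite -mem_suppT E inE eqxx.
case/eqP: f0; apply/rowP=> i; rewrite mxE; apply/mpolyP=> t; rewrite mcoeff0.
by apply/eqP; have := mem_suppT f (t, i); rewrite E /= => /esym/negbFE.
Qed.

(** A form of [T(f) <= t] that makes sense, and holds, for [f = 0] too. *)
Definition bounded f t := forall s, coefT f s != 0 -> le_term s t.

Lemma coefT_monoZ a w f s :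
  coefT (mono D a w *: f) s = a * (ore_terml D w (f 0 s.2))@_s.1.
Proof.
rewrite /coefT mxE; rewrite -[RHS]mcoeffZ; congr (mcoeff _ _); exact: ore_mul_term.
Qed.

(** The support bound for component [i] of [Y^w * f] when [f] is bounded by [t]; the module ordering
    compares terms of different components, so [i] may differ from [t.2]. *)
Let Q t i w s := le_term (s, i) (tmul w t).

Let Qshift t i w k s : Q t i w s -> Q t i (U_(k) + w)%MM (U_(k) + s)%MM.
Proof. by move=> /(tmul_le U_(k)); rewrite /Q /tmul /= addmA. Qed.

Let Qweaken t i w k s : Q t i w s -> Q t i (U_(k) + w)%MM s.
Proof.
rewrite /Q /le_term => /le_lt_term_trans; have := lt_tmul_var k (tmul w t).
by rewrite /tmul /= addmA => lt1 -> //; rewrite orbT.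
Qed.

Lemma bounded_monoZ a w f t : bounded f t -> bounded (mono D a w *: f) (tmul w t).
Proof.
move=> ft [s i]; rewrite coefT_monoZ /= => nz.
apply: (@ore_terml_supp _ _ D (Q t i) (@Qshift t i) (@Qweaken t i) w (f 0 i)).
  by move=> r /(ft (r, i)); rewrite /Q /tmul /= add0m; case: (t).
by apply: contraNneq nz => ->; rewrite mulr0.
Qed.

Lemma coefT_monoZ_top a w f t : bounded f t ->
  coefT (mono D a w *: f) (tmul w t) = a * alpha_term D w (coefT f t).
Proof.
case: t => t i ft; rewrite coefT_monoZ /=; congr (_ * _).
apply: (@ore_terml_top _ _ D (Q (t, i) i) (@Qshift _ i) (@Qweaken _ i)).
  by move=> r /(ft (r, i)); rewrite /Q /tmul /= add0m.
move=> v k; apply/negP => /orP[/eqP|] E; have := lt_tmul_var k (v + t, i)%MM; rewrite /tmul /=.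
  by rewrite E /tmul /= (lt_irrefl _ lt_wf).
by case: lt_wf => tr _ _ /tr/(_ E); rewrite (lt_irrefl _ lt_wf).
Qed.

Lemma bounded_lterm f t : lterm lt f = Some t -> bounded f t.
Proof.
by case/(ltermP _ _ lt_wf) => _ H s /H[->|st]; rewrite /le_term ?eqxx // st orbT.
Qed.

Lemma lterm_le f t t' : bounded f t' -> lterm lt f = Some t -> le_term t t'.
Proof. by move=> ft' /(ltermP _ _ lt_wf)[/ft']. Qed.

Lemma lterm_None f : lterm lt f = None -> f = 0.
Proof.
move=> f0; apply/eqP; apply/negP => /negP /coefT_neq0[t]; rewrite -mem_suppT.
move: f0; rewrite /lterm; case: (suppT f) => //= x r.
by case: (foldr _ _ _).
Qed.

Lemma lterm_Some f : f != 0 -> exists t, lterm lt f = Some t.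
Proof. by case E: (lterm lt f) => [t|]; [exists t | rewrite (lterm_None E) eqxx]. Qed.

End Module.
End LeadingTerms.

Lemma exact_divK (R : comNzRingType) (a b : R) : divides a b -> exact_div b a * a = b.
Proof. by move=> ab; rewrite -(epsilon_spec (inhabits 0) _ ab). Qed.

Lemma subm_addm_subm (n : nat) (r s t : 'X_{1..n}) :
  (r <= s)%MM -> (s <= t)%MM -> ((t - s) + (s - r) = t - r)%MM.
Proof.
move=> /mnm_lepP rs /mnm_lepP st; apply/mnmP=> i.
by rewrite !mnmE addnBA // subnK.
Qed.

(** * Submodules, and sums of monomial multiples of the same degree *)

Section Lspan.
Context (A : nzRingType) (V : lmodType A) (B : V -> Prop).

Lemma lspan0 : lspan B 0.
Proof. by exists [::] => //; rewrite big_nil. Qed.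

Lemma lspanD v w : lspan B v -> lspan B w -> lspan B (v + w).
Proof.
case=> [r rB ->] [s sB ->]; exists (r ++ s); last by rewrite big_cat.
by move=> x; rewrite mem_cat => /orP[/rB|/sB].
Qed.

Lemma lspan_scale a b : B b -> lspan B (a *: b).
Proof. by exists [:: (a, b)] => [x|]; rewrite ?big_seq1 // inE => /eqP->. Qed.

Lemma lspanN v : lspan B v -> lspan B (- v).
Proof.
case=> s sB ->; exists [seq (- x.1, x.2) | x <- s].
  by move=> x /mapP[y /sB By ->].
by rewrite big_map -sumrN; apply: eq_bigr => x _; rewrite scaleNr.
Qed.

End Lspan.

Lemma monoD (n : nat) (R : nzRingType) (D : ore_data n R) a b t :
  mono D (a + b) t = mono D a t + mono D b t.
Proof. exact: scalerDl. Qed.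

Lemma mono0 (n : nat) (R : nzRingType) (D : ore_data n R) t : mono D 0 t = 0.
Proof. exact: scale0r. Qed.

Lemma monoN (n : nat) (R : nzRingType) (D : ore_data n R) a t :
  mono D (- a) t = - mono D a t.
Proof. exact: scaleNr. Qed.

Section HomogeneousSum.
Context (n u : nat) (R : nzRingType) (D : ore_data n R) (V : lmodType (ore D)).
Context (tau : 'I_u -> 'X_{1..n}) (e : 'I_u -> V) (s : 'X_{1..n}).
Implicit Types a b : 'rV[R]_u.

(** Serves both for syzygies, with [e] the canonical basis over [graded D], and for elements of the
    module, with [e = g] over [D]. Subtraction of exponents is truncated, so [a] is meant to vanish
    where [tau i] does not divide [s]. *)
Definition homsum a : V := \sum_i mono D (a 0 i) (s - tau i) *: e i.

Lemma homsumD : {morph homsum : a b / a + b}.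
Proof.
move=> a b; rewrite -big_split; apply: eq_bigr => i _.
by rewrite mxE monoD scalerDl.
Qed.

Lemma homsum0 : homsum 0 = 0.
Proof. by rewrite /homsum big1 // => i _; rewrite mxE mono0 scale0r. Qed.

Lemma homsum_delta x i : homsum (x *: delta_mx 0 i) = mono D x (s - tau i) *: e i.
Proof.
rewrite /homsum (bigD1 i) //= big1 => [|j Nji].
  by rewrite !mxE !eqxx mulr1 addr0.
by rewrite !mxE (negPf Nji) andbF mulr0 mono0 scale0r.
Qed.

Lemma homsum_pair x y i j :
  homsum (x *: delta_mx 0 j - y *: delta_mx 0 i) =
  mono D x (s - tau j) *: e j - mono D y (s - tau i) *: e i.
Proof. by rewrite -scaleNr homsumD !homsum_delta monoN scaleNr. Qed.

End HomogeneousSum.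

(** * Syzygies of the leading coefficients in a fixed degree *)

Section GroebnerBases.
Context (R : idomainType) (hPID : principal_ideal_domain R).
Context (n m u : nat) (D : ore_data n R).
Hypothesis haut : forall i : 'I_n, bijective (alpha D i).
Context (ltT : rel 'X_{1..n}) (hltT : term_order ltT).
Context (lt : rel (term n m)) (hlt : compatible_term_order ltT lt).
Context (g : 'I_u -> 'rV[ore D]_m).
Context (c : 'I_u -> R) (tau : 'I_u -> 'X_{1..n}) (l : 'I_u -> 'I_m).
Hypothesis hM : forall i, lterm lt (g i) = Some (tau i, l i) /\ lcoef lt (g i) = c i.
Context (cc : 'I_u -> 'I_u -> R).
Hypothesis hcc : forall i j : 'I_u, (i < j)%N -> l i = l j ->
  is_lcm (acoef D c tau i j) (acoef D c tau j i) (cc i j).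

Let T i : term n m := (tau i, l i).

Let lgT i : lterm lt (g i) = Some (T i). Proof. by case: (hM i). Qed.

Let coefT_g i : coefT (g i) (T i) = c i.
Proof. by case: (hM i); rewrite /lcoef => ->. Qed.

Let c_neq0 i : c i != 0.
Proof. by rewrite -coefT_g; case: (ltermP (g i) (T i) (lt_wf hlt)) => /(_ (lgT i)) []. Qed.

Let lmon_g i : lmon lt (g i) = mono (graded D) (c i) (tau i) *: delta_mx 0 (l i).
Proof. by case: (hM i) => gT gc; rewrite /lmon gT gc. Qed.

Definition active (t : term n m) i := (l i == t.2) && (tau i <= t.1)%MM.

Let tau_lcmC i j : tau_lcm tau i j = tau_lcm tau j i. Proof. exact: mlcmC. Qed.

Lemma lcm_le t i j : active t i -> active t j -> (tau_lcm tau i j <= t.1)%MM.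
Proof. by move=> /andP[_ it] /andP[_ jt]; rewrite lem_mlcm it. Qed.

(** Composing [alpha] along [t/tau(i,j)] and [tau(i,j)/tau_i] gives [alpha] along [t/tau_i]; this
    carries the lcm condition from degree [tau(i,j)] to degree [t]. *)
Lemma alpha_acoef t i j : active t i -> active t j ->
  alpha_term D (t.1 - tau_lcm tau i j) (acoef D c tau i j) =
  alpha_term D (t.1 - tau i) (c i).
Proof.
move=> ti tj; rewrite /acoef -alpha_termD subm_addm_subm ?lem_mlcml //.
exact: lcm_le.
Qed.

Lemma exact_div_acoef (i j : 'I_u) : (i < j)%N -> l i = l j ->
  exact_div (cc i j) (acoef D c tau j i) * acoef D c tau j i = cc i j /\
  exact_div (cc i j) (acoef D c tau i j) * acoef D c tau i j = cc i j.
Proof. by move=> ij lij; case: (hcc ij lij) => ? ? _; split; apply: exact_divK. Qed.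

(* The vector in the third premise holds the coefficients of [q w * b(i,j)]. *)
Lemma homogeneous_syzygy_ind (t : term n m) (P : 'rV[R]_u -> Prop) :
  P 0 -> (forall v w, P v -> P w -> P (v + w)) ->
  (forall (i j : 'I_u) q (w := (t.1 - tau_lcm tau i j)%MM),
     (i < j)%N -> l i = l j -> active t i -> active t j ->
     P ((q * alpha_term D w (exact_div (cc i j) (acoef D c tau j i))) *: delta_mx 0 j
        - (q * alpha_term D w (exact_div (cc i j) (acoef D c tau i j)))
          *: delta_mx 0 i)) ->
  forall a : 'rV[R]_u, (forall i, ~~ active t i -> a 0 i = 0) ->
  \sum_i a 0 i * alpha_term D (t.1 - tau i) (c i) = 0 -> P a.
Proof.
move=> P0 PD Pb; apply: (syzygy_pairwise_ind hPID _ P0 PD (A := active t)).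
  by move=> i _; rewrite alpha_term_eq0.
move=> i j x y ij ti tj xyE.
have lij : l i = l j by case/andP: ti tj => /eqP-> _ /andP[/eqP->].
have [ejE eiE] := exact_div_acoef ij lij.
have [_ _ lcmP] := hcc ij lij.
pose w := (t.1 - tau_lcm tau i j)%MM.
have wi : alpha_term D w (acoef D c tau i j) = alpha_term D (t.1 - tau i) (c i).
  exact: alpha_acoef.
have wj : alpha_term D w (acoef D c tau j i) = alpha_term D (t.1 - tau j) (c j).
  by rewrite /w tau_lcmC; exact: alpha_acoef.
(* Surjectivity of [alpha_w] pulls the common multiple and its two cofactors back to degree
   [tau(i,j)]. *)
have [z zE] := alpha_term_surj w (x * alpha_term D (t.1 - tau j) (c j)) haut.
have [x' xE] := alpha_term_surj w x haut.
have [y' yE] := alpha_term_surj w y haut.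
(* By injectivity of [alpha_w], [z] is a common multiple of [a_ij] and [a_ji], hence [q] times
   [cc i j]. Cancelling the nonzero leading coefficients then determines [x] and [y]. *)
have [||q qE] := lcmP z.
- exists y'; apply: (@alpha_term_inj _ _ D w).
  by rewrite -zE alpha_termM -yE wi.
- exists x'; apply: (@alpha_term_inj _ _ D w).
  by rewrite -zE alpha_termM -xE wj.
have -> : x = alpha_term D w q *
    alpha_term D w (exact_div (cc i j) (acoef D c tau j i)).
  have := c_neq0 j; rewrite -(alpha_term_eq0 D (t.1 - tau j)) => /mulIf.
  by apply; rewrite zE qE -{1}ejE -wj !alpha_termM mulrA.
have -> : y = alpha_term D w q *
    alpha_term D w (exact_div (cc i j) (acoef D c tau i j)).
  have := c_neq0 i; rewrite -(alpha_term_eq0 D (t.1 - tau i)) => /mulIf.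
  by apply; rewrite -xyE zE qE -{1}eiE -wi !alpha_termM mulrA.
exact: Pb.
Qed.

(** * The Gebauer-Moeller set *)

Lemma sLD : {morph sL lt g : h k / h + k}.
Proof.
by move=> h k; rewrite -big_split; apply: eq_bigr => i _; rewrite mxE scalerDl.
Qed.

Lemma sLZ x h : sL lt g (x *: h) = x *: sL lt g h.
Proof. by rewrite scaler_sumr; apply: eq_bigr => i _; rewrite mxE scalerA. Qed.

Lemma sL0 : sL lt g 0 = 0.
Proof. by rewrite /sL big1 // => i _; rewrite mxE scale0r. Qed.

Lemma sL_delta i : sL lt g (delta_mx 0 i) = lmon lt (g i).
Proof.
rewrite /sL (bigD1 i) //= big1 => [|j Nji].
  by rewrite mxE !eqxx scale1r addr0.
by rewrite mxE (negPf Nji) andbF scale0r.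
Qed.

Lemma sL_bsyz (i j : 'I_u) : (i < j)%N -> l i = l j -> sL lt g (bsyz D c tau cc i j) = 0.
Proof.
move=> ij lij; have [ejE eiE] := exact_div_acoef ij lij.
rewrite /bsyz -scaleNr sLD !sLZ scaleNr !sL_delta !lmon_g !scalerA !graded_mulE.
rewrite -[alpha_term D (_ - tau i) _]/(acoef D c tau i j) eiE.
rewrite [in X in mono _ (_ * X)]tau_lcmC -[alpha_term D (_ - tau j) _]/(acoef D c tau j i) ejE.
by rewrite !submK ?lem_mlcml ?lem_mlcmr // lij subrr.
Qed.

Lemma bsyz_homogeneous (i j : 'I_u) : (i < j)%N -> l i = l j ->
  term_homogeneous lt g (bsyz D c tau cc i j).
Proof.
move=> ij lij; pose w k := (tau_lcm tau i j - tau k)%MM.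
pose a : 'rV[R]_u := exact_div (cc i j) (acoef D c tau j i) *: delta_mx 0 j
  - exact_div (cc i j) (acoef D c tau i j) *: delta_mx 0 i.
exists (a 0), w; split.
  by rewrite -[RHS]/(homsum (D := graded D) tau _ (tau_lcm tau i j) a) homsum_pair.
have aN0 k : a 0 k != 0 -> omap (tmul (w k)) (lterm lt (g k)) = Some (tau_lcm tau i j, l i).
  rewrite lgT !mxE /= /tmul /=; have [->|_] := eqVneq k j.
    by rewrite submK ?lem_mlcmr // lij.
  have [->|_] := eqVneq k i; first by rewrite submK ?lem_mlcml.
  by rewrite !mulr0 subrr eqxx.
by move=> k1 k2 /aN0-> /aN0->.
Qed.

(** The degree-[t] component of [h]: entry [i] is the coefficient of [h_i] at the only exponent
    taking [T i] to [t], and 0 if there is none. *)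
Let acomp (h : 'rV[ore (graded D)]_u) (t : term n m) : 'rV[R]_u :=
  \row_i if active t i then mcoeff (t.1 - tau i) (h 0 i) else 0.

Lemma coef_graded_mul_mono (p : ore (graded D)) b v s :
  mcoeff s (p * mono (graded D) b v) =
  if (v <= s)%MM then mcoeff (s - v) p * alpha_term D (s - v) b else 0.
Proof.
elim/mpolyind: p => [|a w p _ _ IH].
  by rewrite [_ * _]mul0r !mcoeff0 mul0r if_same.
rewrite [_ * _](mulrDl (mono (graded D) a w)) [LHS]mcoeffD IH graded_mulE.
rewrite !mcoeffD /mono !mcoeffZ !mcoeffX mulrDl.
have [vs|Nvs] := boolP (v <= s)%MM.
  congr (_ + _); have [->|Nws] := eqVneq w (s - v)%MM.
    by rewrite submK // eqxx !mulr1.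
  have /negPf-> : (w + v)%MM != s by apply: contraNneq Nws => <-; rewrite addmK.
  by rewrite !mulr0 mul0r.
have /negPf-> : (w + v)%MM != s by apply: contraNneq Nvs => <-; rewrite lem_addl.
by rewrite mulr0 addr0.
Qed.

(** As [sL] respects degrees, its kernel is cut out degree by degree by syzygies over [R]. *)
Lemma coefT_sL h t :
  coefT (sL lt g h) t = \sum_i acomp h t 0 i * alpha_term D (t.1 - tau i) (c i).
Proof.
rewrite /sL coefT_sum; apply: eq_bigr => i _.
rewrite mxE /active lmon_g scalerA /coefT !mxE /=.
have [_|_] := eqVneq (l i) t.2; last by rewrite mulr0 mcoeff0 mul0r.
rewrite mulr1 coef_graded_mul_mono.
by case: ifP; rewrite ?mul0r.
Qed.

Lemma homogeneous_decomposition h : exists r : seq (term n m),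
  h = \sum_(t <- r) homsum tau (fun i => delta_mx 0 i) t.1 (acomp h t).
Proof.
(* All degrees occurring in [h], each listed once so that no component is counted twice. *)
exists (undup (flatten [seq [seq tmul v (T i) | v <- msupp (h 0 i)] | i <- enum 'I_u])).
set r := undup _; apply/rowP=> i; apply/mpolyP=> v.
(* The only degree whose component sees the coefficient of [h_i] at [v]. *)
pose t0 := tmul v (T i).
have summE (t : term n m) : mcoeff v
    ((homsum tau (fun i => delta_mx 0 i) t.1 (acomp h t) : 'rV[ore (graded D)]_u) 0 i) =
    if t == t0 then mcoeff v (h 0 i) else 0.
  rewrite summxE (bigD1 i) //= big1 => [|j Nji]; last first.
    by rewrite !mxE /= eq_sym (negPf Nji) mulr0.
  rewrite addr0 !mxE !eqxx mulr1 /mono mcoeffZ mcoeffX /active.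
  have [->|Nt] := eqVneq t t0; first by rewrite /= eqxx lem_addl addmK eqxx mulr1.
  case: ifP => [/andP[/eqP lt2 tt]|_]; last by rewrite mul0r.
  have [tE|_] := eqVneq (t.1 - tau i)%MM v; last by rewrite mulr0.
  case/eqP: Nt; rewrite /t0 /tmul /= -tE submK // lt2.
  by case: (t).
rewrite summxE [RHS](raddf_sum (mcoeff v)).
rewrite (eq_bigr _ (fun t _ => summE t)) -big_mkcond /=.
have [t0r|Nt0r] := boolP (t0 \in r).
  by rewrite (big_rem t0) //= eqxx big_seq_cond big1 ?addr0 // => t /andP[];
     rewrite mem_rem_uniq ?undup_uniq // inE => /andP[/negPf->].
rewrite big_seq_cond big1 => [|t /andP[tr /eqP tE]]; last by rewrite -tE tr in Nt0r.
apply: memN_msupp_eq0; apply: contra Nt0r => vh.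
by rewrite mem_undup; apply/flatten_mapP; exists i; rewrite ?mem_enum //; apply/mapP; exists v.
Qed.

Lemma gebauer_moeller :
  left_gebauer_moeller_set lt g
    (fun b => exists i j : 'I_u,
       [/\ (i < j)%N, l i = l j & b = bsyz D c tau cc i j]).
Proof.
split=> [b [i [j [ij lij ->]]]|h]; first exact: bsyz_homogeneous.
split=> [[r rB ->]|h0].
  elim: r rB => [|x r IH] rB; first by rewrite big_nil sL0.
  rewrite big_cons sLD sLZ IH ?addr0; last by move=> y yr; apply: rB; rewrite inE yr orbT.
  have [|i [j [ij lij ->]]] := rB x; first by rewrite inE eqxx.
  by rewrite sL_bsyz // scaler0.
have [r ->] := homogeneous_decomposition h.
apply: big_ind => [||t _]; [exact: lspan0 | exact: lspanD |].
pose P a := lspan (fun b => exists i j : 'I_u,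
       [/\ (i < j)%N, l i = l j & b = bsyz D c tau cc i j])
       (homsum tau (fun i => delta_mx 0 i) t.1 a).
apply: (@homogeneous_syzygy_ind t P).
- by rewrite /P homsum0; exact: lspan0.
- by move=> a b; rewrite /P homsumD; exact: lspanD.
- move=> i j q w ij lij ti tj; rewrite /P homsum_pair.
  (* Factoring [t/tau_j] and [t/tau_i] through [tau(i,j)] lets the graded product pull out [q w] on
     the left, leaving [b(i,j)]. *)
  rewrite -(subm_addm_subm (lem_mlcmr (tau i) (tau j)) (lcm_le ti tj)).
  rewrite -(subm_addm_subm (lem_mlcml (tau i) (tau j)) (lcm_le ti tj)).
  rewrite -!graded_mulE -!scalerA -scalerBr; apply: lspan_scale.
  by exists i, j.
- by move=> i /negPf ti; rewrite mxE ti.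
by rewrite -coefT_sL h0 coefT0.
Qed.

(** * Buchberger's criterion *)

(** Weak representations with an arbitrary condition on the terms [w T(g_j)], so that the bound need
    not be tied to the maximal term of [f]. *)
Definition rep (Q : pred (term n m)) (f : 'rV[ore D]_m) : Prop :=
  exists2 s : seq (R * 'X_{1..n} * 'I_u),
    forall a w j, (a, w, j) \in s -> a != 0 /\ Q (tmul w (T j))
  & f = \sum_(x <- s) mono D x.1.1 x.1.2 *: g x.2.

(** For [f = 0] the condition is [false], which leaves only the empty representation. *)
Lemma weak_groebner_repE f : left_weak_groebner_rep lt g f <->
  rep (fun s => if lterm lt f is Some t then le_term lt s t else false) f.
Proof.
split=> -[s sP fE]; exists s => // a w j /sP; rewrite lgT /le_oterm /le_term /=;
  by case: (lterm lt f).
Qed.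

Lemma rep0 Q : rep Q 0.
Proof. by exists [::] => //; rewrite big_nil. Qed.

Lemma repD Q f h : rep Q f -> rep Q h -> rep Q (f + h).
Proof.
case=> [r rQ ->] [s sQ ->]; exists (r ++ s); last by rewrite big_cat.
by move=> a w j; rewrite mem_cat => /orP[/rQ|/sQ].
Qed.

Lemma rep_sub (Q Q' : pred (term n m)) f :
  (forall t, Q t -> Q' t) -> rep Q f -> rep Q' f.
Proof. by move=> QQ' [s sQ ->]; exists s => // a w j /sQ[a0 /QQ']. Qed.

Lemma rep_mono (Q : pred (term n m)) a w j :
  Q (tmul w (T j)) -> rep Q (mono D a w *: g j).
Proof.
move=> Qw; have [->|a0] := eqVneq a 0; first by rewrite mono0 scale0r; exact: rep0.
exists [:: (a, w, j)]; last by rewrite big_seq1.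
by move=> b v k; rewrite inE => /eqP[-> -> ->].
Qed.

Lemma rep_oreZ (Q : pred (term n m)) (p : ore D) j :
  (forall v, mcoeff v p != 0 -> Q (tmul v (T j))) -> rep Q (p *: g j).
Proof.
move=> pQ; rewrite (_ : p = \sum_(v <- msupp p) mono D (mcoeff v p) v); last exact: mpolyE.
rewrite scaler_suml big_seq; apply: big_ind => [||v]; [exact: rep0 | exact: repD |].
by rewrite mcoeff_msupp => /pQ; exact: rep_mono.
Qed.

(** Multiplying a summand by [q w] produces the graded product and a tail of smaller terms; both
    stay below [w t]. *)
Lemma rep_monoZ (Q : pred (term n m)) f t q w :
  rep Q f -> (forall s, Q s -> lt s t) -> rep (lt^~ (tmul w t)) (mono D q w *: f).
Proof.
move=> [s sQ ->] Qt; have [[tr _ _] mulT mulT'] := hlt.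
rewrite scaler_sumr big_seq; apply: big_ind => [||[[a v] j] /sQ[_ /Qt vt]];
  [exact: rep0 | exact: repD |].
rewrite /= scalerA; have [p -> pv] := ore_mono_mul hltT D q a w v.
have vt' : lt (tmul (w + v) (T j)) (tmul w t).
  by have := mulT' w _ _ vt; rewrite /tmul /= addmA.
rewrite scalerDl; apply: repD; first exact: rep_mono.
by apply: rep_oreZ => v' /pv /(mulT _ _ (T j)) /tr; apply.
Qed.

Lemma rep_bounded t f : rep (le_term lt^~ t) f -> bounded lt f t.
Proof.
case=> s sQ -> r; rewrite coefT_sum => nz.
have [[[a w] j] /sQ[_ wt] ar] : exists2 x, x \in s &
    coefT (mono D x.1.1 x.1.2 *: g x.2) r != 0.
  apply/hasP; apply: contraNT nz => /hasPn H; rewrite big_seq big1 // => x /H.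
  by rewrite negbK => /eqP.
have /(_ r ar) := bounded_monoZ hltT hlt (a := a) (w := w) (bounded_lterm hlt (lgT j)).
rewrite /le_term => /orP[/eqP->|rw]; first exact: wt.
by rewrite (lt_le_term_trans hlt rw wt) orbT.
Qed.

(** The largest of the finitely many terms used is itself an admissible bound. This turns a strict
    bound into a smaller non-strict one, as well-founded induction requires. *)
Lemma rep_lt_le Q f : rep Q f -> f = 0 \/ exists2 t, Q t & rep (le_term lt^~ t) f.
Proof.
case=> s sQ ->; elim: s sQ => [|[[a w] j] s IH] sQ; first by rewrite big_nil; left.
rewrite big_cons; right.
have [_ Qw] := sQ _ _ _ (mem_head _ _).
have wj : rep (le_term lt^~ (tmul w (T j))) (mono D a w *: g j).
  by apply: rep_mono; rewrite /le_term eqxx.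
have [|->|[t Qt st]] := IH; first by move=> b v k bs; apply: sQ; rewrite inE bs orbT.
  by exists (tmul w (T j)); rewrite ?addr0.
have letr r1 r2 r3 : le_term lt r1 r2 -> le_term lt r2 r3 -> le_term lt r1 r3.
  move=> /orP[/eqP->//|r12 r23]; rewrite /le_term.
  by rewrite (lt_le_term_trans hlt r12 r23) orbT.
have [le_wt|lt_tw] := le_term_total hlt (tmul w (T j)) t.
  by exists t => //; apply: repD st; apply: rep_sub wj => r /letr; apply.
exists (tmul w (T j)) => //; apply: repD wj _; apply: rep_sub st => r /letr; apply.
by rewrite /le_term lt_tw orbT.
Qed.

(** * Cancellation in the top degree of a representation *)

Let dsum (t : term n m) (a : 'rV[R]_u) :=
  \sum_i a 0 i * alpha_term D (t.1 - tau i) (c i).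

Lemma dsumD t : {morph dsum t : a b / a + b}.
Proof.
by move=> a b; rewrite -big_split; apply: eq_bigr => i _; rewrite mxE mulrDl.
Qed.

Lemma dsum0 t : dsum t 0 = 0.
Proof. by rewrite /dsum big1 // => i _; rewrite mxE mul0r. Qed.

Lemma rep_split t f : rep (le_term lt^~ t) f ->
  exists (s : seq (R * 'X_{1..n} * 'I_u)) f',
  [/\ forall a w j, (a, w, j) \in s -> a != 0 /\ tmul w (T j) = t,
      rep (lt^~ t) f' & f = \sum_(x <- s) mono D x.1.1 x.1.2 *: g x.2 + f'].
Proof.
case=> s sQ ->; pose B (x : R * 'X_{1..n} * 'I_u) := tmul x.1.2 (T x.2) == t.
exists (filter B s), (\sum_(x <- filter (predC B) s) mono D x.1.1 x.1.2 *: g x.2).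
split.
- by move=> a w j; rewrite mem_filter => /andP[/eqP /= wt /sQ[]].
- exists (filter (predC B) s) => // a w j; rewrite mem_filter => /andP[NB /sQ[a0]].
  rewrite /le_term.
  by have /negPf-> : tmul w (T j) != t by exact: NB.
by rewrite (bigID B) /= !big_filter.
Qed.

Lemma coefT_rep_lt t f : rep (lt^~ t) f -> coefT f t = 0.
Proof.
move=> /rep_lt_le[->|[r rt /rep_bounded fr]]; first exact: coefT0.
apply/eqP/negPn/negP => /fr tr; have := lt_le_term_trans hlt rt tr.
by rewrite (lt_irrefl _ (lt_wf hlt)).
Qed.

Lemma coefT_top_sum t (s : seq (R * 'X_{1..n} * 'I_u)) :
  (forall a w j, (a, w, j) \in s -> a != 0 /\ tmul w (T j) = t) ->
  coefT (\sum_(x <- s) mono D x.1.1 x.1.2 *: g x.2) t =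
  \sum_(x <- s) x.1.1 * alpha_term D x.1.2 (c x.2).
Proof.
move=> sP; rewrite coefT_sum; apply: eq_big_seq => -[[a w] j] /sP[_ <-] /=.
by rewrite (coefT_monoZ_top hltT hlt a w (bounded_lterm hlt (lgT j))) coefT_g.
Qed.

(** The scalar is the one in [coefT_top_sum], so top terms combine under the Ore product as the
    leading monomials do in the graded module. *)
Lemma lmon_top_sum t (s : seq (R * 'X_{1..n} * 'I_u)) :
  (forall a w j, (a, w, j) \in s -> a != 0 /\ tmul w (T j) = t) ->
  \sum_(x <- s) mono (graded D) x.1.1 x.1.2 *: lmon lt (g x.2) =
  mono (graded D) (\sum_(x <- s) x.1.1 * alpha_term D x.1.2 (c x.2)) t.1
    *: delta_mx 0 t.2.
Proof.
move=> sP; rewrite (big_morph (fun a => mono (graded D) a t.1)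
  (fun a b => monoD (graded D) a b t.1) (mono0 (graded D) t.1)).
rewrite scaler_suml; apply: eq_big_seq => -[[a w] j] /sP[_ <-] /=.
by rewrite lmon_g scalerA graded_mulE.
Qed.

(** Both halves of [B(i,j)] are bounded by [tau(i,j)] and have coefficient [cc i j] there, so these
    cancel. *)
Lemma lterm_Spoly_lt (i j : 'I_u) t : (i < j)%N -> l i = l j ->
  lterm lt (Spoly g c tau cc i j) = Some t -> lt t (tau_lcm tau i j, l i).
Proof.
move=> ij lij; have [ejE eiE] := exact_div_acoef ij lij.
pose t0 : term n m := (tau_lcm tau i j, l i).
have Tj : tmul (tau_lcm tau i j - tau j) (T j) = t0.
  by rewrite /tmul /= submK ?lem_mlcmr // -lij.
have Ti : tmul (tau_lcm tau i j - tau i) (T i) = t0.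
  by rewrite /tmul /= submK ?lem_mlcml.
have bnd k a w : bounded lt (mono D a w *: g k) (tmul w (T k)).
  exact: (bounded_monoZ hltT hlt (a := a) (w := w) (bounded_lterm hlt (lgT k))).
have top k a w : coefT (mono D a w *: g k) (tmul w (T k)) = a * alpha_term D w (c k).
  by rewrite (coefT_monoZ_top hltT hlt a w (bounded_lterm hlt (lgT k))) coefT_g.
have S0 : coefT (Spoly g c tau cc i j) t0 = 0.
  rewrite /Spoly coefTD coefTN -{1}Tj -Ti !top.
  rewrite -[alpha_term D (_ - tau i) _]/(acoef D c tau i j) eiE tau_lcmC.
  by rewrite -[alpha_term D (_ - tau j) _]/(acoef D c tau j i) ejE subrr.
move=> /(ltermP _ _ (lt_wf hlt))[]; rewrite /Spoly coefTD coefTN => St _.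
have : le_term lt t t0.
  have [/bnd|/negbNE/eqP S1] := boolP (coefT (mono D (exact_div (cc i j) (acoef D c tau j i))
      (tau_lcm tau i j - tau j) *: g j) t != 0); first by rewrite Tj.
  by move: St; rewrite S1 sub0r oppr_eq0 => /bnd; rewrite Ti.
rewrite /le_term => /orP[/eqP tE|//]; case/eqP: St.
by rewrite tE -[RHS]S0 /Spoly coefTD coefTN.
Qed.

(** The vanishing top coefficient is a syzygy over [R] in degree [t]; its two-index pieces are
    multiples of the [B(i,j)] up to terms below [t]. *)
Lemma rep_reduce t f :
  (forall i j : 'I_u, (i < j)%N -> l i = l j ->
     left_weak_groebner_rep lt g (Spoly g c tau cc i j)) ->
  rep (le_term lt^~ t) f -> coefT f t = 0 -> rep (lt^~ t) f.
Proof.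
move=> SP /rep_split[s [f' [sP f'_lt ->]]] ft0; apply: repD (f'_lt).
have {ft0} st0 : \sum_(x <- s) x.1.1 * alpha_term D x.1.2 (c x.2) = 0.
  by rewrite -(coefT_top_sum sP) -ft0 coefTD (coefT_rep_lt f'_lt) addr0.
(* Within degree [t] the index [j] determines the exponent [t/tau_j], so scalars with the same index
   can be added. *)
pose a : 'rV[R]_u := \sum_(x <- s) x.1.1 *: delta_mx 0 x.2.
have actS b w j : (b, w, j) \in s -> active t j /\ (t.1 - tau j)%MM = w.
  by case/sP => _ <-; rewrite /active /= eqxx lem_addl addmK.
have -> : \sum_(x <- s) mono D x.1.1 x.1.2 *: g x.2 = homsum tau g t.1 a.
  rewrite (big_morph _ (homsumD tau g t.1) (homsum0 tau g t.1)).
  apply: eq_big_seq => -[[b w] j] /actS[_ /= <-].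
  by rewrite homsum_delta.
apply: (@homogeneous_syzygy_ind t (fun a => rep (lt^~ t) (homsum tau g t.1 a))).
- by rewrite homsum0; exact: rep0.
- by move=> v w; rewrite homsumD; exact: repD.
- move=> i j q w ij lij ti tj; rewrite homsum_pair.
  have w_j : (w + (tau_lcm tau i j - tau j) = t.1 - tau j)%MM.
    by rewrite subm_addm_subm ?lem_mlcmr ?lcm_le.
  have w_i : (w + (tau_lcm tau i j - tau i) = t.1 - tau i)%MM.
    by rewrite subm_addm_subm ?lem_mlcml ?lcm_le.
  have wt : tmul w (tau_lcm tau i j, l i) = t.
    rewrite /tmul /w /= submK ?lcm_le //.
    by case/andP: ti => /eqP-> _; case: (t).
  have [p pE pv] := ore_mono_mul hltT D q (exact_div (cc i j) (acoef D c tau j i)) w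
    (tau_lcm tau i j - tau j).
  have [p' p'E p'v] := ore_mono_mul hltT D q (exact_div (cc i j) (acoef D c tau i j)) w
    (tau_lcm tau i j - tau i).
  have lower k (p0 : ore D) : active t k ->
      (forall v : 'X_{1..n}, mcoeff v p0 != 0 -> ltT v (t.1 - tau k)%MM) ->
      rep (lt^~ t) (p0 *: g k).
    move=> /andP[/eqP lk tk] p0v; apply: rep_oreZ => v /p0v vk.
    have [_ mulT _] := hlt; have := mulT _ _ (T k) vk.
    by rewrite /tmul /= submK // lk; case: (t).
  (* Here [p] and [p'] are the lower tails by which the Ore products in [q w * B(i,j)] differ from
     the graded ones. *)
  have -> :
      mono D (q * alpha_term D w (exact_div (cc i j) (acoef D c tau j i))) (t.1 - tau j) *: g j
    - mono D (q * alpha_term D w (exact_div (cc i j) (acoef D c tau i j))) (t.1 - tau i) *: g i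
    = mono D q w *: Spoly g c tau cc i j + (- p *: g j + p' *: g i).
    rewrite /Spoly scalerBr !scalerA pE p'E w_j w_i !scalerDl scaleNr opprD.
    by rewrite addrACA addrK addrNK.
  apply: repD; last apply: repD.
  (* The terms representing [B(i,j)] are at most its maximal term, which is below [tau(i,j)];
     multiplication by [w] brings them below [t]. *)
  - rewrite -wt; have /weak_groebner_repE Srep := SP i j ij lij.
    apply: (rep_monoZ _ _ Srep) => r.
    case E: (lterm lt (Spoly g c tau cc i j)) => [r'|//] rr'.
    exact: (le_lt_term_trans hlt rr' (lterm_Spoly_lt ij lij E)).
  - by apply: lower => // v; rewrite mcoeffN oppr_eq0 => /pv; rewrite w_j.
  by apply: lower => // v /p'v; rewrite w_i.
- move=> i NAi; rewrite summxE big_seq big1 // => -[[b w] j] /actS[tj _].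
  rewrite !mxE /=; have [ij|] := eqVneq i j; last by rewrite mulr0.
  by rewrite ij tj in NAi.
rewrite -[RHS]st0 -[LHS]/(dsum t a) /a.
rewrite (big_morph (dsum t) (dsumD t) (dsum0 t)).
apply: eq_big_seq => -[[b w] j] /actS[_ /= <-].
rewrite /dsum (bigD1 j) //= big1 => [|i /negPf Nij].
  by rewrite !mxE !eqxx mulr1 addr0.
by rewrite !mxE Nij andbF mulr0 mul0r.
Qed.

(** * The two implications of the criterion *)

Lemma coefT_mono_delta a (t : term n m) :
  coefT (mono (graded D) a t.1 *: delta_mx 0 t.2 : 'rV_m) t = a.
Proof. by rewrite /coefT !mxE !eqxx mulr1 /mono mcoeffZ mcoeffX eqxx mulr1. Qed.

(** Division: the basis property expresses [M(f)] by leading monomials. The same combination [S] of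
    the [g j] under the Ore product has this leading monomial, so [f - S] is zero or has a smaller
    maximal term. *)
Lemma groebner_rep f : left_groebner_basis lt g -> left_ideal_gen g f ->
  left_weak_groebner_rep lt g f.
Proof.
move=> gb gf; apply/weak_groebner_repE.
case fE: (lterm lt f) => [t|]; last by rewrite (lterm_None fE); exact: rep0.
(* The claim is generalised to every bound [t] of [f], so that the induction applies to the
   remainder. *)
move: gf (bounded_lterm hlt fE) => {fE}; have [_ _ wf] := lt_wf hlt.
elim: (wf t) f => {}t _ IH f gf ft.
have [->|f0] := eqVneq f 0; first exact: rep0.
have [t' ft'] := lterm_Some lt f0.
have t't := lterm_le hlt ft ft'.
have [s sP fE] := gb f gf f0.
have {}sP a w j : (a, w, j) \in s -> a != 0 /\ tmul w (T j) = t'.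
  by case/sP; rewrite lgT ft' => a0 [].
have lfE : lcoef lt f = \sum_(x <- s) x.1.1 * alpha_term D x.1.2 (c x.2).
  move: fE; rewrite (lmon_top_sum sP) /lmon ft' => /(congr1 (@coefT _ _ _ _ ^~ t')).
  by rewrite !coefT_mono_delta.
pose S := \sum_(x <- s) mono D x.1.1 x.1.2 *: g x.2.
have Srep : rep (le_term lt^~ t') S.
  by exists s => // a w j /sP[a0 ->]; rewrite /le_term eqxx.
have letr r : le_term lt r t' -> le_term lt r t.
  move=> /orP[/eqP->//|rt']; rewrite /le_term.
  by rewrite (lt_le_term_trans hlt rt' t't) orbT.
have gS : left_ideal_gen g (f - S).
  apply: lspanD gf (lspanN _); rewrite /S; apply: big_ind.
  - exact: lspan0.
  - exact: lspanD.
  by move=> x _; apply: lspan_scale; exists x.2.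
rewrite -(subrK S f); apply: repD; last exact: rep_sub Srep.
have [->|fS0] := eqVneq (f - S) 0; first exact: rep0.
have [r rE] := lterm_Some lt fS0.
have rt' : lt r t'.
  have [nz _] := proj1 (ltermP (f - S) r (lt_wf hlt)) rE.
  have : le_term lt r t'.
    have [/(bounded_lterm hlt ft')//|/negbNE/eqP fr] := boolP (coefT f r != 0).
    move: nz; rewrite coefTD coefTN fr sub0r oppr_eq0.
    exact: rep_bounded Srep _.
  case/orP => [/eqP rt'|//]; case/eqP: nz.
  rewrite rt' coefTD coefTN /S (coefT_top_sum sP) -lfE.
  by rewrite /lcoef ft' subrr.
have rt := lt_le_term_trans hlt rt' t't.
apply: rep_sub (IH r rt _ gS (bounded_lterm hlt rE)) => q.
case/orP => [/eqP->|qr]; first by rewrite /le_term rt orbT.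
by rewrite /le_term (lt_le_term_trans hlt qr) ?orbT // /le_term rt orbT.
Qed.

(** Start from any representation and let [t] be its largest term. If the coefficient of [f] at [t]
    vanishes, [rep_reduce] lowers the bound; otherwise [t] is the maximal term of [f]. *)
Lemma rep_groebner :
  (forall i j : 'I_u, (i < j)%N -> l i = l j ->
     left_weak_groebner_rep lt g (Spoly g c tau cc i j)) ->
  left_groebner_basis lt g.
Proof.
move=> SP f [r rg fE] f0.
have /rep_lt_le[f0'|[t _]] : rep predT f.
- rewrite fE big_seq; apply: big_ind => [||x /rg[i ->]]; [exact: rep0 | exact: repD |].
  by apply: rep_oreZ.
- by rewrite f0' eqxx in f0.
have [_ _ wf] := lt_wf hlt; elim: (wf t) => {}t _ IH ft.
have [ft0|ftN0] := eqVneq (coefT f t) 0.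
  have /rep_lt_le[f0'|[t' t't]] := rep_reduce SP ft ft0.
    by rewrite f0' eqxx in f0.
  exact: IH.
have ltf : lterm lt f = Some t.
  apply/(ltermP _ _ (lt_wf hlt)); split=> // q /(rep_bounded ft)/orP[/eqP|]; by auto.
(* The summands of degree exactly [t] already account for the leading coefficient, so they express
   [M(f)]. *)
have [s [f' [sP f'_lt fE']]] := rep_split ft.
exists s => [a w j /sP[a0 wt]|]; first by rewrite lgT ltf /= wt.
rewrite (lmon_top_sum sP) /lmon ltf /lcoef ltf; congr (mono _ _ _ *: _).
by rewrite fE' coefTD (coefT_top_sum sP) (coefT_rep_lt f'_lt) addr0.
Qed.

Lemma Spoly_ideal i j : left_ideal_gen g (Spoly g c tau cc i j).
Proof.
by apply: lspanD; [|apply: lspanN]; apply: lspan_scale; [exists j|exists i].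
Qed.

End GroebnerBases.

Theorem corollary51
  (R : idomainType) (hZ : left_zacharias R) (hPID : principal_ideal_domain R)
  (n m u : nat) (D : ore_data n R)
  (haut : forall i : 'I_n, bijective (alpha D i))
  (ltT : rel 'X_{1..n}) (hltT : term_order ltT)
  (lt : rel (term n m)) (hlt : compatible_term_order ltT lt)
  (g : 'I_u -> 'rV[ore D]_m) (hg : forall i, g i != 0)
  (c : 'I_u -> R) (tau : 'I_u -> 'X_{1..n}) (l : 'I_u -> 'I_m)
  (hM : forall i, lterm lt (g i) = Some (tau i, l i) /\ lcoef lt (g i) = c i)
  (cc : 'I_u -> 'I_u -> R)
  (hcc : forall i j : 'I_u, (i < j)%N -> l i = l j ->
     is_lcm (acoef D c tau i j) (acoef D c tau j i) (cc i j)) :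
  left_gebauer_moeller_set lt g
    (fun b => exists i j : 'I_u,
       [/\ (i < j)%N, l i = l j & b = bsyz D c tau cc i j])
  /\
  (left_groebner_basis lt g <->
   forall i j : 'I_u, (i < j)%N -> l i = l j ->
     left_weak_groebner_rep lt g (Spoly g c tau cc i j)).
Proof.
split; first exact: (gebauer_moeller hPID haut hlt hM hcc).
split=> [gb i j ij lij|SP].
  exact: (groebner_rep hltT hlt hM gb (Spoly_ideal _ _ _ _ _ _)).
exact: (rep_groebner hPID haut hltT hlt hM hcc SP).
Qed.
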